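(* Let $k$ be a field, and let $Z=\{(P,a),(Q,b)\}$ be two fat points in $\mathbb P^{n_1}\times\cdots\times\mathbb P^{n_r}$ with $a\ge b\ge 1$, i.e. the scheme with defining ideal $I_Z=I_P^a\cap I_Q^b$, where $P\neq Q$. Set $N=n_1+\cdots+n_r$. If $P$ and $Q$ are in linear general position, then for all $i\ge 0$ \begin{align*} \beta_{i,i+a}(I_Z)={}&\binom{N-r+a-1}{a+i}\binom{a+i-1}{i}\\ &+\sum_{j=1}^{a-b}\sum_{k=0}^{r-1}\binom{k+j-1}{j-1}\binom{N-r+a-j-1}{a-j}\binom{N-r+k}{i},\\ \beta_{i,i+a+1}(I_Z)={}&\sum_{i_1+i_2+i_3=i}\binom{r}{1+i_1}\binom{r+a-b}{a-b+1+i_2}\binom{a-b+i_2}{i_2}\binom{N-r+b-2}{b-1+i_3}\binom{b+i_3-2}{i_3}\\ &+\sum_{i_1+i_2+i_3=i-1}\binom{r}{1+i_1}\binom{r+a-b}{a-b+1+i_2}\binom{a-b+i_2}{i_2}\binom{N-r+b-1}{b+i_3}\binom{b+i_3-1}{i_3},\\ \beta_{i,i+a+j}(I_Z)={}&\sum_{k_1=0}^{r-1}\sum_{k_2=0}^{r-1}\binom{N-r+b-j-1}{b-j}\binom{k_1+a-b+j-1}{a-b+j-1}\binom{k_2+j-1}{j-1}\binom{N-r+k_1+k_2}{i} \end{align*} for $j=2,\dots,b$ in the last formula, and $\beta_{i,j}(I_Z)=0$ for all other $i,j\ge 0$.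
   Context: Let $r\ge 1$, $n_1,\dots,n_r\ge 1$. The coordinate ring of $\mathbb P^{n_1}\times\cdots\times\mathbb P^{n_r}$ (over $k$) is $R=k[x_{1,0},\dots,x_{1,n_1},\dots,x_{r,0},\dots,x_{r,n_r}]$. The defining ideal of a point $P=P_1\times\cdots\times P_r$ is $I_P=(L_{1,1},\dots,L_{1,n_1},\dots,L_{r,1},\dots,L_{r,n_r})$, where $L_{i,1},\dots,L_{i,n_i}$ are linear forms in $x_{i,0},\dots,x_{i,n_i}$ generating the ideal of $P_i\in\mathbb P^{n_i}$. A $(d_1,\dots,d_r)$-linear subspace is $\mathcal L=\mathcal L_{d_1}\times\cdots\times\mathcal L_{d_r}$ where each $\mathcal L_{d_i}\subseteq\mathbb P^{n_i}$ is a linear subspace of dimension $d_i\in\{0,\dots,n_i\}$ and $d_j<n_j$ for at least one $j$. A set of points $X$ is in linear general position if every $(d_1,\dots,d_r)$-linear subspace contains at most $d+1$ points of $X$, where $d=\min\{d_1,\dots,d_r\}$. (In particular distinct points of $X$ have distinct $i$-th coordinates for every $i$.) $\beta_{i,j}(I_Z)$ denotes the $\mathbb N$-graded Betti numbers of the ideal $I_Z$ as an $R$-module with respect to the standard grading of $R$ (all variables of degree $1$): the number of copies of $R(-j)$ in homological degree $i$ of the minimal graded free resolution $\cdots\to F_1\to F_0\to I_Z\to 0$. In the sums, $i_1,i_2,i_3$ range over nonnegative integers. Binomial conventions: $\binom{p}{0}=1$ for every integer $p$ (including $p=-1$), and $\binom{p}{q}=0$ if $q>0$ and $p<q$. Empty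 sums are $0$. The summation index $k$ is an integer, unrelated to the field $k$. *)

(* Defs.v *)
From Stdlib Require Import ClassicalEpsilon.
From HB Require Import structures.
From mathcomp Require Import all_boot all_order all_algebra.
From mathcomp Require Import mpoly.

Set Implicit Arguments.
Unset Strict Implicit.
Unset Printing Implicit Defensive.

Import GRing.Theory.
Local Open Scope ring_scope.

Section Ideals.
Variable A : comNzRingType.
Implicit Types I J : A -> Prop.

Definition ideal_gen (S : A -> Prop) : A -> Prop := fun f =>
  exists s : seq (A * A),
    (forall c, c \in s -> S c.2) /\ f = \sum_(c <- s) c.1 * c.2.

Definition ideal_mul I J : A -> Prop :=
  ideal_gen (fun f => exists g h, [/\ I g, J h & f = g * h]).

(* The 0-th power is the unit ideal. *)
Definition ideal_pow I (a : nat) : A -> Prop :=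
  iter a (ideal_mul I) (fun=> True).

Definition ideal_cap I J : A -> Prop := fun f => I f /\ J f.

End Ideals.

Section Resolutions.
Variables (k : fieldType) (m : nat).
Local Notation R := {mpoly k[m]}.

(* F_i is the direct sum of the R(- gshift i q), q < grank i; its elements are
   row vectors, on which gdiff i : F_(i+1) -> F_i and gaug : F_0 -> R act by
   right multiplication. *)
Record free_complex := FreeComplex {
  grank : nat -> nat;
  gshift : forall i, 'I_(grank i) -> nat;
  gdiff : forall i, 'M[R]_(grank i.+1, grank i);
  gaug : 'cV[R]_(grank 0)
}.

(* p defines a degree-preserving map R(-d) -> R(-e); the case split avoids
   truncated subtraction. *)
Definition homog_entry (d e : nat) (p : R) : bool :=
  if (e <= d)%N then p \is (d - e)%N.-homog else p == 0.

Definition is_graded (F : free_complex) : Prop :=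
  (forall i p q, homog_entry (gshift p) (gshift q) (gdiff F i p q)) /\
  (forall p, homog_entry (gshift p) 0 (gaug F p 0)).

(* ... -> F_1 -> F_0 -> I -> 0 is exact. *)
Definition is_resolution (F : free_complex) (I : R -> Prop) : Prop :=
  [/\ forall f, I f <-> exists v : 'rV_(grank F 0), (v *m gaug F) 0 0 = f,
      forall v : 'rV_(grank F 0),
        v *m gaug F = 0 <-> exists w : 'rV_(grank F 1), v = w *m gdiff F 0
    & forall i (v : 'rV_(grank F i.+1)),
        v *m gdiff F i = 0 <-> exists w : 'rV_(grank F i.+2), v = w *m gdiff F i.+1].

(* The image of F_(i+1) lies in the product of the ideal of all variables
   with F_i. *)
Definition is_minimal (F : free_complex) : Prop :=
  forall i p q, (gdiff F i p q)@_0%MM = 0.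

Definition min_graded_resolution (F : free_complex) (I : R -> Prop) : Prop :=
  [/\ is_graded F, is_resolution F I & is_minimal F].

Definition shift_mult (F : free_complex) (i j : nat) : nat :=
  #|[set q : 'I_(grank F i) | gshift q == j]|.

(* The shift multiplicity does not depend on the minimal graded free
   resolution; the value is unspecified if I has none. *)
Definition betti (I : R -> Prop) (i j : nat) : nat :=
  epsilon (inhabits 0%N) (fun c : nat =>
    exists F, min_graded_resolution F I /\ c = shift_mult F i j).

End Resolutions.

Section MultiProjective.
Variables (k : fieldType) (r : nat) (n : 'I_r -> nat).

Definition proj_point (l : nat) := {U : {vspace 'rV[k]_l.+1} | \dim U == 1%N}.

Definition multi_point := {dffun forall i : 'I_r, proj_point (n i)}.

(* The factors are given by their cones: L i is the vector subspace of
   k^(n_i + 1) over a linear subspace of projective dimension d i. *)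
Definition is_linear_subspace (d : 'I_r -> nat)
    (L : forall i : 'I_r, {vspace 'rV[k]_(n i).+1}) : Prop :=
  (forall i, \dim (L i) = (d i).+1) /\ (exists j, (d j < n j)%N).

Definition on_subspace (L : forall i : 'I_r, {vspace 'rV[k]_(n i).+1}) :
    pred multi_point :=
  fun P => [forall i, (val (P i) <= L i)%VS].

(* d i0 below is the minimum of the d i. *)
Definition linear_general_position (X : seq multi_point) : Prop :=
  forall d L, is_linear_subspace d L ->
  forall i0, (forall i, (d i0 <= d i)%N) ->
    (count (on_subspace L) (undup X) <= (d i0).+1)%N.

Local Notation R := {mpoly k[\sum_(i < r) (n i).+1]}.

Definition coord_var (i : 'I_r) (j : 'I_(n i).+1) : R :=
  'X_(tagnat.Rank (p_ := fun i => (n i).+1) i j).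

Definition linear_form (i : 'I_r) (v : 'rV[k]_(n i).+1) : R :=
  \sum_j v 0 j *: coord_var j.

(* The ideal of P i is generated by any basis of the linear forms vanishing
   at P i, hence by all of them. *)
Definition point_ideal (P : multi_point) : R -> Prop :=
  ideal_gen (fun f => exists (i : 'I_r) (v : 'rV[k]_(n i).+1),
    (forall w, w \in val (P i) -> \sum_j v 0 j * w 0 j = 0) /\
    f = linear_form v).

Definition two_fat_points_ideal (P Q : multi_point) (a b : nat) : R -> Prop :=
  ideal_cap (ideal_pow (point_ideal P) a) (ideal_pow (point_ideal Q) b).

End MultiProjective.

(* Binomial coefficient with integer top: it is 1 for q = 0, and 0 for p < q
   and 0 < q, negative p included. *)
Definition binz (p : int) (q : nat) : nat :=
  if p is Posz p' then 'C(p', q) else (q == 0%N).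
Arguments binz p%_ring_scope q%_nat_scope.

(* Main.v *)
(** In each factor choose coordinates in which [P] is the first and [Q] the second
    coordinate point; linear general position makes this possible. Writing [x],
    [y], [z] for the first, the second and the remaining coordinates of all the
    factors, the ideal is spanned by the monomials of degree at least [a] in
    [y, z] and at least [b] in [x, z], so it is minimally generated by the
    monomials of [z]-degree [c <= a], [y]-degree [a - c] and [x]-degree
    [b - c] (zero if [c >= b]). Ordered by decreasing [c], and reverse
    lexicographically for equal [c], these generators have linear quotients: each
    successive colon ideal is generated by variables, namely by all [z] (only by
    those below the largest one in the generator if [c = a]) together with
    the [x] and the [y] below the largest [x] and the largest [y] of the
    generator. An iterated mapping cone of Koszul complexes is then a graded free
    resolution, minimal because the degrees of the generators do not decrease.
    Hence the Betti numbers are the sums of ['C(s, i)] over the generators, [s]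
    being the number of variables of the colon ideal. *)
From Stdlib Require Import ClassicalEpsilon.
Require Import Defs.
From HB Require Import structures.
From mathcomp Require Import all_boot all_order all_algebra.
From mathcomp Require Import mpoly.
From mathcomp Require Import zify ring.

Set Implicit Arguments.
Unset Strict Implicit.
Unset Printing Implicit Defensive.

(** * Graded matrices and comparison of minimal resolutions *)

(** Dependent choice along a family of types: [P] is the invariant that makes the next choice
    possible, [Q] the relation between neighbours. Chain maps and homotopies are built with it, one
    degree at a time. *)
Lemma dep_choice_from (T : nat -> Type) (P : forall i, T i -> Prop)
    (Q : forall i, T i -> T i.+1 -> Prop) (x0 : T 0) :
  P 0 x0 -> (forall i x, P i x -> exists y, P i.+1 y /\ Q i x y) ->
  exists f : forall i, T i, f 0 = x0 /\ forall i, P i (f i) /\ Q i (f i) (f i.+1).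
Proof.
move=> Px0 step.
have next i (x : {x | P i x}) : {y | P i.+1 y /\ Q i (sval x) y}.
  by apply: constructive_indefinite_description; apply: step; apply: svalP x.
pose f := fix f i : {x | P i x} :=
  if i is i'.+1 then exist _ _ (proj1 (svalP (next i' (f i')))) else exist _ _ Px0.
exists (fun i => sval (f i)); split=> // i; split; first exact: svalP (f i).
exact: proj2 (svalP (next i (f i))).
Qed.

Section GradedMatrices.
Import GRing.Theory.
Local Open Scope ring_scope.
Variables (k : fieldType) (n : nat).
Local Notation R := {mpoly k[n]}.

Lemma mx_row_eq0 p q (A : 'M[R]_(p, q)) : (forall w : 'rV_p, w *m A = 0) -> A = 0.
Proof. by move=> A0; apply/row_matrixP => i; rewrite rowE A0 row0. Qed.

Lemma mx_solve p q l (D : 'M[R]_(q, l)) (B : 'M[R]_(p, l)) :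
  (forall i, exists w, w *m D = row i B) -> exists A, A *m D = B.
Proof.
move=> solve.
pose w i := sval (constructive_indefinite_description _ (solve i)).
exists (\matrix_i w i); apply/row_matrixP => i.
by rewrite row_mul rowK; apply: svalP (constructive_indefinite_description _ (solve i)).
Qed.

Lemma homog_entryM d e f (p q : R) :
  homog_entry d e p -> homog_entry e f q -> homog_entry d f (p * q).
Proof.
rewrite /homog_entry; case: (leqP e d) => [led|_ /eqP->]; last first.
  by move=> _; rewrite mul0r eqxx rpred0; case: ifP.
case: (leqP f e) => [lfe|_ _ /eqP->]; last first.
  by rewrite mulr0 eqxx rpred0; case: ifP.
by move=> hp hq; rewrite (leq_trans lfe led); have := dhomogM hp hq; rewrite addnBA ?subnK.
Qed.

Lemma homog_entry_sum d e I (r : seq I) (F : I -> R) :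
  (forall i, homog_entry d e (F i)) -> homog_entry d e (\sum_(i <- r) F i).
Proof.
rewrite /homog_entry; case: (e <= d)%N => homF; first exact: rpred_sum.
by rewrite big1 // => i _; apply/eqP.
Qed.

Lemma homog_entryDl c d e (p : R) :
  homog_entry (c + d) (c + e) p = homog_entry d e p.
Proof. by rewrite /homog_entry leq_add2l subnDl. Qed.

Lemma homog_entry0 d e : homog_entry d e (0 : R).
Proof. by rewrite /homog_entry rpred0 eqxx; case: ifP. Qed.

Lemma homog_entryN d e (p : R) : homog_entry d e (- p) = homog_entry d e p.
Proof. by rewrite /homog_entry rpredN oppr_eq0. Qed.

Lemma homog_entry1 d : homog_entry d d (1 : R).
Proof. by rewrite /homog_entry leqnn subnn dhomog1. Qed.

Lemma homog_entry_coeff0 d e (p : R) : homog_entry d e p -> d != e -> p@_0%MM = 0.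
Proof.
rewrite /homog_entry; case: (leqP e d) => [led hp ned|_ /eqP->]; last by rewrite mcoeff0.
by rewrite (dhomog_nemf_coeff hp) //= mdeg0; apply/eqP; lia.
Qed.

(** Projection of [p], seen as a map R(-d) -> R(-e), onto its degree-preserving part. *)
Definition homog_part d e (p : R) : R :=
  if (e <= d)%N then pihomog mdeg (d - e) p else 0.

Lemma homog_part_entry d e p : homog_entry d e (homog_part d e p).
Proof.
by rewrite /homog_entry /homog_part; case: (e <= d)%N => //; apply: (pihomogP mdeg).
Qed.

Lemma homog_part_id d e p : homog_entry d e p -> homog_part d e p = p.
Proof.
rewrite /homog_entry /homog_part; case: ifP => [_|_ /eqP//]; exact: pihomog_dE.
Qed.

Lemma homog_part_sum d e I (r : seq I) (F : I -> R) :
  homog_part d e (\sum_(i <- r) F i) = \sum_(i <- r) homog_part d e (F i).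
Proof.
rewrite /homog_part; case: ifP => _; first exact: raddf_sum.
by rewrite big1.
Qed.

Lemma pihomogM c d (p q : R) : q \is c.-homog ->
  pihomog mdeg (d + c) (p * q) = pihomog mdeg d p * q.
Proof.
move=> hq; rewrite [in LHS](mpolyE p) [in RHS](mpolyE p) mulr_suml !linear_sum mulr_suml /=.
apply: eq_bigr => m _; have hm : p@_m *: 'X_[m] * q \is (mdeg m + c).-homog.
  by apply: dhomogM => //; apply: dhomogZ; rewrite dhomogX.
have [Em|ned] := eqVneq (mdeg m) d.
  by subst d; rewrite !pihomog_dE // dhomogZ // dhomogX.
rewrite (pihomog_ne0 _ hm) ?eqn_add2r // (@pihomog_ne0 _ _ _ (mdeg m)) ?mul0r //.
by rewrite dhomogZ // dhomogX.
Qed.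

Lemma pihomogM_small c d (p q : R) : q \is c.-homog -> (d < c)%N ->
  pihomog mdeg d (p * q) = 0.
Proof.
move=> hq ltdc; rewrite [p]mpolyE mulr_suml linear_sum /=.
rewrite big1 // => m _; have hm : p@_m *: 'X_[m] * q \is (mdeg m + c).-homog.
  by apply: dhomogM => //; apply: dhomogZ; rewrite dhomogX.
by rewrite (pihomog_ne0 _ hm) //; apply/eqP; lia.
Qed.

Lemma homog_partM s t u (p q : R) : homog_entry t u q ->
  homog_part s u (p * q) = homog_part s t p * q.
Proof.
rewrite /homog_entry /homog_part; case: (leqP u t) => [lut hq|_ /eqP->]; last first.
  by rewrite !mulr0 raddf0; case: ifP.
case: (leqP t s) => [lts|lst].
  by rewrite (leq_trans lut lts) -(pihomogM _ _ hq) addnBA ?subnK.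
rewrite mul0r; case: ifP => // lus; apply: pihomogM_small hq _; lia.
Qed.

Definition graded_mx p q (s : 'I_p -> nat) (t : 'I_q -> nat) (A : 'M[R]_(p, q)) :=
  forall i j, homog_entry (s i) (t j) (A i j).

Lemma graded_mxM p q l s t u (A : 'M[R]_(p, q)) (B : 'M[R]_(q, l)) :
  graded_mx s t A -> graded_mx t u B -> graded_mx s u (A *m B).
Proof.
move=> hA hB i j; rewrite mxE; apply: homog_entry_sum => x.
exact: homog_entryM (hA _ _) (hB _ _).
Qed.

(** Solve without regard to degrees, then project every entry to its prescribed degree: as [D] and
    [B] are graded, the projection of the equation is the equation for the projected matrix. *)
Lemma graded_mx_solve p q l s t u (D : 'M[R]_(q, l)) (B : 'M[R]_(p, l)) :
  graded_mx t u D -> graded_mx s u B ->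
  (forall i, exists w, w *m D = row i B) ->
  exists A, graded_mx s t A /\ A *m D = B.
Proof.
move=> hD hB /mx_solve[A AD].
exists (\matrix_(i, j) homog_part (s i) (t j) (A i j)); split=> [i j|].
  by rewrite mxE; apply: homog_part_entry.
apply/matrixP => i j; rewrite -(homog_part_id (hB i j)) -AD !mxE homog_part_sum.
by apply: eq_bigr => x _; rewrite mxE (homog_partM _ _ (hD x j)).
Qed.

End GradedMatrices.

Section Resolutions.
Import GRing.Theory.
Local Open Scope ring_scope.
Variables (k : fieldType) (n : nat).
Local Notation R := {mpoly k[n]}.
Local Notation cpx := (free_complex k n).

(* The augmented complex, re-indexed so that R sits in degree 0 and the
   augmentation becomes an ordinary differential. *)
Definition arank (F : cpx) i := if i is i'.+1 then grank F i' else 1%N.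

Definition ashift (F : cpx) i : 'I_(arank F i) -> nat :=
  match i with 0 => fun=> 0%N | i'.+1 => @gshift _ _ F i' end.

Definition adiff (F : cpx) i : 'M[R]_(arank F i.+1, arank F i) :=
  match i with 0 => gaug F | i'.+1 => gdiff F i' end.

Lemma adiff_graded F : is_graded F ->
  forall i, graded_mx (@ashift F i.+1) (@ashift F i) (adiff F i).
Proof. by move=> [hF haug] [|i] p q; [|exact: hF]; rewrite (ord1 q); apply: haug. Qed.

Arguments adiff_graded [F] grF i p q : rename.

Lemma adiff_image F I f : is_resolution F I ->
  I f <-> exists v, v *m adiff F 0 = f%:M.
Proof.
move=> [im0 _ _]; rewrite im0; split=> -[v vf]; exists v.
  by rewrite -vf; apply/matrixP => i j; rewrite !ord1 !mxE eqxx mulr1n.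
by rewrite vf mxE eqxx mulr1n.
Qed.

Lemma adiff_exact F I : is_resolution F I -> forall i (v : 'rV_(arank F i.+1)),
  v *m adiff F i = 0 <-> exists w, v = w *m adiff F i.+1.
Proof. by move=> [_ ex0 ex] [|i] v; [apply: ex0 | apply: ex]. Qed.

Lemma adiff_adiff F I : is_resolution F I -> forall i, adiff F i.+1 *m adiff F i = 0.
Proof.
move=> resF i; apply: mx_row_eq0 => w; rewrite mulmxA.
by apply/(adiff_exact resF); exists w.
Qed.

(** The comparison theorem for multiplication by a form of degree [d]. With [phi0 = 1] it compares
    two resolutions of one ideal; with a generator as [phi0] it supplies the map of a mapping
    cone. *)
Lemma chain_map_lift F G I J (d : nat) (phi0 : 'M[R]_1) :
    is_graded F -> is_resolution F I -> is_graded G -> is_resolution G J ->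
    graded_mx (fun=> d) (fun=> 0%N) phi0 -> (forall h, J h -> I (h * phi0 0 0)) ->
  exists phi : forall i, 'M[R]_(arank G i, arank F i),
    phi 0%N = phi0 /\
    forall i, graded_mx (fun x => (d + @ashift G i x)%N) (@ashift F i) (phi i) /\
              phi i.+1 *m adiff F i = adiff G i *m phi i.
Proof.
move=> grF resF grG resG hphi0 JI.
(* Besides gradedness, the invariant says that [A] after the differential of [G] lands in the image
   of [F], which is what the next lift requires. *)
pose P i (A : 'M[R]_(arank G i, arank F i)) :=
  graded_mx (fun x => (d + @ashift G i x)%N) (@ashift F i) A /\
  forall x, exists w, w *m adiff F i = row x (adiff G i *m A).
pose Q i (A : 'M[R]_(arank G i, arank F i)) (B : 'M[R]_(arank G i.+1, arank F i.+1)) :=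
  B *m adiff F i = adiff G i *m A.
have [||phi [phi00 hphi]] := @dep_choice_from _ P Q phi0; last first.
- by exists phi; split=> // i; have [[]] := hphi i.
- move=> i A [hA imA].
  have hGA : graded_mx (fun x => d + @ashift G i.+1 x)%N (@ashift F i) (adiff G i *m A).
    apply: graded_mxM hA => x y; rewrite homog_entryDl; exact: adiff_graded.
  have [B [hB BF]] := graded_mx_solve (adiff_graded grF i) hGA imA.
  exists B; split=> //; split=> // x.
  have /(adiff_exact resF) [w ->] : row x (adiff G i.+1 *m B) *m adiff F i = 0.
    by rewrite -row_mul -mulmxA BF mulmxA (adiff_adiff resG) mul0mx row0.
  by exists w.
- split=> [x y|x]; first by rewrite /= addn0.
  have Jx : J (adiff G 0 x 0).
    apply/(adiff_image _ resG); exists (delta_mx 0 x); rewrite -rowE.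
    by apply/matrixP => i j; rewrite !ord1 !mxE eqxx mulr1n.
  have [w wF] := (adiff_image _ resF).1 (JI _ Jx).
  by exists w; rewrite wF; apply/matrixP => i j; rewrite !ord1 !mxE big_ord1 eqxx mulr1n.
Qed.

(** The homotopy relation is solved for [h i.+1]: by the relation in the degree below, the rows of
    the right-hand side are cycles, hence boundaries. *)
Lemma null_homotopy F I (chi : forall i, 'M[R]_(arank F i)) :
    is_resolution F I -> chi 0%N = 0 ->
    (forall i, chi i.+1 *m adiff F i = adiff F i *m chi i) ->
  exists h : forall i, 'M[R]_(arank F i, arank F i.+1),
    h 0%N = 0 /\ forall i, chi i.+1 = h i.+1 *m adiff F i.+1 + adiff F i *m h i.
Proof.
move=> resF chi0 chiF.
pose P i (A : 'M[R]_(arank F i, arank F i.+1)) :=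
  forall x, exists w, w *m adiff F i.+1 = row x (chi i.+1 - adiff F i *m A).
pose Q i (A : 'M[R]_(arank F i, arank F i.+1)) (B : 'M[R]_(arank F i.+1, arank F i.+2)) :=
  B *m adiff F i.+1 = chi i.+1 - adiff F i *m A.
have [||h [h0 hh]] := @dep_choice_from _ P Q 0; last first.
- by exists h; split=> // i; have [_ ->] := hh i; rewrite subrK.
- move=> i A /mx_solve[B BF]; exists B; split=> // x.
  have /(adiff_exact resF) [w ->] :
      row x (chi i.+2 - adiff F i.+1 *m B) *m adiff F i.+1 = 0.
    rewrite -row_mul mulmxBl chiF -mulmxA BF mulmxBr mulmxA (adiff_adiff resF) mul0mx subr0.
    by rewrite subrr row0.
  by exists w.
- move=> x; have /(adiff_exact resF) [w ->] :
      row x (chi 1%N - adiff F 0 *m 0) *m adiff F 0 = 0.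
    by rewrite -row_mul mulmx0 subr0 chiF chi0 mulmx0 row0.
  by exists w.
Qed.

(** The composite of the comparison maps is homotopic to the identity, and minimality kills the
    homotopy terms modulo the variables. So the constant terms of [phi] have a right inverse; by
    homogeneity this holds separately on the summands of shift [j], and ranks over the field can be
    compared. *)
Lemma leq_shift_mult (F G : cpx) I i j :
  min_graded_resolution F I -> min_graded_resolution G I ->
  (shift_mult F i j <= shift_mult G i j)%N.
Proof.
move=> [grF resF minF] [grG resG minG].
have id0 : graded_mx (fun=> 0%N) (fun=> 0%N) (1%:M : 'M[R]_1).
  by move=> x y; rewrite !ord1 mxE eqxx; apply: homog_entry1.
have idI h : I h -> I (h * (1%:M : 'M[R]_1) 0 0) by rewrite mxE mulr1.
have [phi [phi0 hphi]] := chain_map_lift grG resG grF resF id0 idI.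
have [psi [psi0 hpsi]] := chain_map_lift grF resF grG resG id0 idI.
pose chi l : 'M[R]_(arank F l) := phi l *m psi l - 1%:M.
have chi0 : chi 0%N = 0 by rewrite /chi phi0 psi0 mulmx1 subrr.
have chiF l : chi l.+1 *m adiff F l = adiff F l *m chi l.
  rewrite /chi mulmxBl mulmxBr mul1mx mulmx1 -mulmxA (proj2 (hpsi l)).
  by rewrite mulmxA (proj2 (hphi l)) mulmxA.
have [h [h0 hchi]] := null_homotopy resF chi0 chiF.
pose c0 p q (A : 'M[R]_(p, q)) : 'M[k]_(p, q) := map_mx (@mcoeff n k 0%MM) A.
have c0M p q l (A : 'M_(p, q)) (B : 'M_(q, l)) : c0 _ _ (A *m B) = c0 _ _ A *m c0 _ _ B.
  exact: map_mxM.
have c0F l : c0 _ _ (adiff F l.+1) = 0 by apply/matrixP => x y; rewrite !mxE minF.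
have c0chi : c0 _ _ (chi i.+1) = 0.
  rewrite hchi [LHS]map_mxD -!/(c0 _ _ _) !c0M c0F mulmx0 add0r.
  (* For [i = 0] the second summand contains the augmentation, about which minimality says nothing;
     it vanishes because [h 0 = 0]. *)
  by case: (i) => [|l]; rewrite ?h0 ?c0F ?mul0mx // [X in _ *m X]map_mx0 mulmx0.
have c0inv : c0 _ _ (phi i.+1) *m c0 _ _ (psi i.+1) = 1%:M.
  apply/eqP; rewrite -subr_eq0 -c0M; apply/eqP; rewrite -c0chi.
  by apply/matrixP => x y; rewrite !mxE mcoeffB mcoeffMn mcoeff1 eqxx.
pose S := [set q : 'I_(grank F i) | gshift q == j].
pose T := [set q : 'I_(grank G i) | gshift q == j].
pose A := \matrix_(x < #|S|, y < #|T|) c0 _ _ (phi i.+1) (enum_val x) (enum_val y).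
pose B := \matrix_(y < #|T|, x < #|S|) c0 _ _ (psi i.+1) (enum_val y) (enum_val x).
apply: (@mulmx1_min _ _ _ A B); apply/matrixP => x y; rewrite !mxE.
rewrite -(inj_eq enum_val_inj).
move/matrixP/(_ (enum_val x) (enum_val y)): c0inv; rewrite !mxE => <-.
(* An entry of [phi] between different shifts has no constant term, so only the indices of shift [j]
   contribute. *)
rewrite (bigID (mem T)) /= [X in _ + X]big1 ?addr0; last first.
  move=> z zT; rewrite mxE (homog_entry_coeff0 (proj1 (hphi i.+1) _ _)) ?mul0r //=.
  have := enum_valP x; rewrite inE => /eqP ->; rewrite inE in zT; by rewrite eq_sym.
rewrite [RHS]big_enum_val.
by apply: eq_bigr => z _; rewrite !mxE.
Qed.

Lemma betti_shift_mult (F : cpx) I i j : min_graded_resolution F I ->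
  betti I i j = shift_mult F i j.
Proof.
move=> resF; rewrite /betti; have [|G [resG ->]] := epsilon_spec (inhabits 0%N) (fun c : nat =>
    exists F : cpx, min_graded_resolution F I /\ c = shift_mult F i j).
  by exists (shift_mult F i j), F.
by apply/eqP; rewrite eqn_leq (leq_shift_mult i j resF resG) (leq_shift_mult i j resG resF).
Qed.

End Resolutions.

(** * Mapping cones *)

Lemma card_set_sum (T : finType) (P : pred T) : #|[set x | P x]| = \sum_x P x.
Proof. by rewrite -sum1dep_card big_mkcond; apply: eq_bigr => x _; case: (P x). Qed.

Section MappingCone.
Import GRing.Theory.
Local Open Scope ring_scope.
Variables (k : fieldType) (n : nat).
Local Notation R := {mpoly k[n]}.
Local Notation cpx := (free_complex k n).

Variables (F G : cpx) (d : nat) (u : R).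
Variable phi : forall i, 'M[R]_(arank G i, arank F i).

Definition cone_shift i (q : 'I_(grank F i + arank G i)) : nat :=
  match split q with inl x => gshift x | inr y => d + ashift y end.

(** The mapping cone of a lift [phi] of multiplication by [u]. The augmented complex of [G] is used,
    so its term R in degree 0 becomes the new generator, sent to [u]. *)
Definition cone : cpx := @FreeComplex k n
  (fun i => grank F i + arank G i)%N cone_shift
  (fun i => block_mx (gdiff F i) 0 (phi i.+1) (- adiff G i))
  (col_mx (gaug F) (phi 0)).

Lemma cone_shift_l i x : @cone_shift i (lshift _ x) = gshift x.
Proof. by rewrite /cone_shift (unsplitK (inl _ x)). Qed.

Lemma cone_shift_r i y : @cone_shift i (rshift _ y) = (d + ashift y)%N.
Proof. by rewrite /cone_shift (unsplitK (inr _ y)). Qed.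

Lemma cone_mult i j : shift_mult cone i j =
  (shift_mult F i j + #|[set y : 'I_(arank G i) | d + ashift y == j]|)%N.
Proof.
rewrite /shift_mult !card_set_sum big_split_ord /=.
by congr (_ + _)%N; apply: eq_bigr => x _; rewrite ?cone_shift_l ?cone_shift_r.
Qed.

Hypothesis phi0 : phi 0 = u%:M.
Hypothesis phiS : forall i, phi i.+1 *m adiff F i = adiff G i *m phi i.
Hypothesis phi_graded : forall i, 
  graded_mx (fun x => (d + @ashift _ _ G i x)%N) (@ashift _ _ F i) (phi i).

Lemma cone_graded : is_graded F -> is_graded G -> is_graded cone.
Proof.
move=> grF grG; split=> [i p q|p] /=.
  case: (split_ordP p) => x ->; case: (split_ordP q) => y ->.
  - by rewrite block_mxEul !cone_shift_l; apply: (proj1 grF).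
  - by rewrite block_mxEur mxE homog_entry0.
  - rewrite block_mxEdl cone_shift_l cone_shift_r; exact: (@phi_graded i.+1).
  rewrite block_mxEdr !cone_shift_r mxE homog_entryN homog_entryDl.
  exact: adiff_graded.
case: (split_ordP p) => x ->.
  by rewrite col_mxEu cone_shift_l; apply: (proj2 grF).
rewrite col_mxEd cone_shift_r; exact: (@phi_graded 0).
Qed.

(** Here [J] is the colon ideal I : u and [K] is I + (u), so multiplication by [u] gives an exact
    sequence 0 -> R/J -> R/I -> R/K -> 0. The proof is the diagram chase for its mapping cone. *)
Lemma cone_resolution I J K : is_resolution F I -> is_resolution G J ->
  (forall h, J h <-> I (h * u)) ->
  (forall f, K f <-> exists g h, I g /\ f = g + h * u) ->
  is_resolution cone K.
Proof.
move=> resF resG colon Kdef.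
have split_v i (v : 'rV_(grank F i + arank G i)) : v = row_mx (lsubmx v) (rsubmx v).
  by rewrite hsubmxK.
(* Common step of the chase: once the [G]-component of a cycle is a boundary of [t], adding the
   image of [t] under [phi] turns the [F]-component into a cycle of [F]. *)
have liftF i (t : 'rV_(arank G i.+1)) (v : 'rV_(grank F i)) :
  v *m adiff F i + (t *m adiff G i) *m phi i = 0 ->
  exists w, v = w *m gdiff F i - t *m phi i.+1.
  move=> vt0; have /(adiff_exact resF) [w wE] : (v + t *m phi i.+1) *m adiff F i = 0.
    by rewrite mulmxDl -mulmxA phiS mulmxA.
  by exists w; rewrite -[gdiff F i]/(adiff F i.+1) -wE addrK.
split=> [f|v|i v].
- rewrite Kdef; split=> [[g [h [/(adiff_image _ resF) [v vg] ->]]]|[v <-]].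
    exists (row_mx v h%:M); rewrite [row_mx v _ *m _]mul_row_col phi0 -scalar_mxM.
    by rewrite [v *m _]vg !mxE eqxx !mulr1n.
  exists ((lsubmx v *m gaug F) 0 0), ((rsubmx v : 'rV_1) 0 0); split.
    by apply/(adiff_image _ resF); exists (lsubmx v); apply/matrixP => i j; rewrite !ord1 !mxE eqxx mulr1n.
  rewrite {1}[v]split_v [row_mx _ _ *m _]mul_row_col mxE phi0; congr (_ + _).
  by rewrite mxE big_ord1 !mxE eqxx mulr1n.
- split=> [|[w ->]]; last first.
    rewrite [w]split_v -mulmxA [block_mx _ _ _ _ *m _]mul_block_col mul0mx addr0 mulNmx.
    have := phiS 0; rewrite /= => ->; rewrite subrr.
    by have := adiff_adiff resF 0; rewrite /= => ->; rewrite col_mx0 mulmx0.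
  rewrite {1}[v]split_v [row_mx _ _ *m _]mul_row_col => v0.
  pose w : 'M[R]_1 := rsubmx v.
  (* In lowest degree the [G]-component is one polynomial whose product with [u] lies in [I]; the
     colon hypothesis replaces exactness. *)
  have /(adiff_image _ resG)[t tw] : J (w 0 0).
    apply/colon/(adiff_image _ resF); exists (- lsubmx v); rewrite mulNmx.
    apply/eqP; rewrite eqr_oppLR -addr_eq0 -v0 phi0; apply/eqP; congr (_ + _).
    by rewrite scalar_mxM; congr (_ *m _); apply/matrixP=> i j; rewrite !ord1 !mxE eqxx mulr1n.
  have wE : w = t *m adiff G 0.
    by rewrite tw; apply/matrixP=> i j; rewrite !ord1 !mxE eqxx mulr1n.
  have [|w' w'E] := liftF 0 t (lsubmx v).
    by rewrite -wE.
  exists (row_mx w' (- t)); rewrite [RHS]mul_row_block mulmx0 add0r mulmxN !mulNmx opprK.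
  by rewrite -wE -w'E -split_v.
- split=> [|[w ->]]; last first.
    rewrite [w]split_v -mulmxA [block_mx _ _ _ _ *m _]mulmx_block !mulmx0 !mul0mx addr0 add0r.
    have := phiS i.+1; rewrite /= => ->; rewrite mulNmx subrr add0r.
    have := adiff_adiff resF i.+1; rewrite /= => ->.
    by rewrite mulmxN mulNmx opprK (adiff_adiff resG) block_mx0 mulmx0.
  rewrite {1}[v]split_v [row_mx _ _ *m _]mul_row_block mulmx0 add0r mulmxN.
  rewrite -row_mx0 => /eq_row_mx [v0 /eqP]; rewrite oppr_eq0 => /eqP/(adiff_exact resG)[t tE].
  have [|w' w'E] := liftF i.+1 t (lsubmx v); first by rewrite -tE.
  exists (row_mx w' (- t)); rewrite [RHS]mul_row_block mulmx0 add0r mulmxN !mulNmx opprK.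
  by rewrite -w'E -tE -split_v.
Qed.

(* The bounds on the shifts give every entry of [phi] positive degree. *)
Lemma cone_minimal : is_minimal F -> is_graded G -> is_minimal G ->
  (forall i (x : 'I_(grank F i)), gshift x <= d + i)%N ->
  (forall i (y : 'I_(grank G i)), i < gshift y)%N ->
  is_minimal cone.
Proof.
move=> minF grG minG shF shG i p q /=.
case: (split_ordP p) => x ->; case: (split_ordP q) => y ->.
- by rewrite block_mxEul minF.
- by rewrite block_mxEur mxE mcoeff0.
- rewrite block_mxEdl (homog_entry_coeff0 (@phi_graded _ _ _)) //=.
  by apply/eqP => /= shE; have := shF _ y; rewrite -shE leq_add2l leqNgt shG.
rewrite block_mxEdr mxE mcoeffN; case: i p q x y => [|i] p q x y.
  rewrite (homog_entry_coeff0 (@adiff_graded _ _ G grG 0 x y)) ?oppr0 //=.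
  by have := shG _ x; case: gshift.
by rewrite /= minG oppr0.
Qed.

End MappingCone.

(** * Ideals with linear quotients *)

Section LinearQuotients.
Import GRing.Theory.
Variables (k : fieldType) (n : nat).
Local Notation R := {mpoly k[n]}.
Local Notation cpx := (free_complex k n).

(** A resolution is kept together with its Betti table, so that an inductive step can extend it by a
    cone. *)
Definition has_betti (I : R -> Prop) (f : nat -> nat -> nat) :=
  exists F : cpx, min_graded_resolution F I /\ forall i j, shift_mult F i j = f i j.

Lemma betti_has_betti I f i j : has_betti I f -> betti I i j = f i j.
Proof. by move=> [F [resF <-]]; apply: betti_shift_mult. Qed.

Lemma has_betti_ext I J f g : has_betti I f ->
  (forall p, I p <-> J p) -> (forall i j, f i j = g i j) -> has_betti J g.
Proof.
move=> [F [[grF [im0 ex0 ex] minF] Ff]] IJ fg; exists F; split; last by move=> i j; rewrite Ff.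
by split=> //; split=> // p; rewrite -IJ.
Qed.

Lemma has_betti0 : has_betti (fun p => p = 0%R) (fun _ _ => 0).
Proof.
pose F : cpx := @FreeComplex k n (fun=> 0) (fun _ _ => 0) (fun=> 0%R) 0%R.
exists F; split=> [|i j]; last by apply: eq_card0 => -[].
split; first by split=> [i []|[]].
  split=> [p|v|i v].
  - by split=> [->|[v <-]]; [exists 0%R; rewrite mul0mx mxE | rewrite mulmx0 mxE].
  - by split=> _; [exists 0%R; apply/matrixP => i [] | rewrite mulmx0].
  - by split=> _; [exists 0%R; apply/matrixP => ? [] | rewrite mulmx0].
by move=> i [].
Qed.

Lemma shift_mult_gt0 (F : cpx) i (x : 'I_(grank F i)) : 0 < shift_mult F i (gshift x).
Proof. by apply/card_gt0P; exists x; rewrite inE. Qed.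

(** [J] has the Betti table of an ideal of [s] independent linear forms. The cone moves it up by one
    homological degree, the new generator accounting for ['C(s, 0)]; the bound on [f] makes the cone
    minimal. *)
Lemma has_betti_colon (I J K : R -> Prop) f s d u :
    has_betti I f -> has_betti J (fun i j => (j == i.+1) * 'C(s, i.+1)) ->
    u \is d.-homog -> (forall i j, 0 < f i j -> j <= d + i) ->
    (forall h, J h <-> I (h * u)%R) ->
    (forall p, K p <-> exists g h, I g /\ p = (g + h * u)%R) ->
  has_betti K (fun i j => f i j + (j == d + i) * 'C(s, i)).
Proof.
move=> [F [[grF resF minF] Ff]] [G [[grG resG minG] Gs]] hu f_le colon Kdef.
have shG i (y : 'I_(grank G i)) : gshift y = i.+1.
  by have := shift_mult_gt0 y; rewrite Gs; case: eqP.
have hu1 : graded_mx (fun=> d) (fun=> 0) (u%:M : 'M_1)%R.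
  by move=> x y; rewrite !ord1 mxE eqxx mulr1n /homog_entry leq0n subn0.
have [h|phi [phi0 hphi]] := chain_map_lift grF resF grG resG hu1.
  by rewrite mxE eqxx mulr1n => /colon.
exists (cone d phi); split; last first.
  move=> i j; rewrite cone_mult Ff; congr (_ + _); case: i => [|i].
    by rewrite card_set_sum big_ord1 bin0 muln1 /= addn0 eq_sym.
  rewrite -[LHS]/(#|[set y : 'I_(grank G i) | d + gshift y == j]|).
  rewrite card_set_sum (eq_bigr (fun=> nat_of_bool (j == d + i.+1))); last first.
    by move=> y _; rewrite shG eq_sym.
  rewrite sum_nat_const card_ord mulnC; congr (_ * _).
  have := Gs i i.+1; rewrite eqxx mul1n => <-.
  rewrite /shift_mult card_set_sum (eq_bigr (fun=> 1)) ?sum1_card ?card_ord //.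
  by move=> y _; rewrite shG eqxx.
split.
- by apply: cone_graded => // i; case: (hphi i).
- have phiS i : (phi i.+1 *m adiff F i = adiff G i *m phi i)%R by case: (hphi i).
  exact (cone_resolution d phi0 phiS resF resG colon Kdef).
- apply: (@cone_minimal _ _ _ _ d) => // [i|i x|i y]; first by case: (hphi i).
    by apply: f_le; rewrite -Ff shift_mult_gt0.
  by rewrite shG.
Qed.

(** * Monomial ideals and their colon ideals *)

Definition monideal (s : seq 'X_{1..n}) (p : R) : Prop :=
  forall m, m \in msupp p -> has (fun g => g <= m)%MM s.

Lemma eq_monideal s t p : s =i t -> monideal s p <-> monideal t p.
Proof. by move=> st; split=> sp m /sp; rewrite (eq_has_r st). Qed.

Lemma monidealD s p q : monideal s p -> monideal s q -> monideal s (p + q)%R.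
Proof. by move=> sp sq m /msuppD_le; rewrite mem_cat => /orP[/sp|/sq]. Qed.

Lemma monideal_sum (I : eqType) s (r : seq I) (P : pred I) (F : I -> R) :
  (forall i, i \in r -> P i -> monideal s (F i)) -> 
  monideal s (\sum_(i <- r | P i) F i)%R.
Proof.
move=> sF; rewrite big_seq_cond; elim/big_ind: _ => [m|p q|i /andP[]].
- by rewrite msupp0.
- exact: monidealD.
- exact: sF.
Qed.

Lemma monidealMX s m p : monideal s (p * 'X_[m])%R <->
  forall m', m' \in msupp p -> has (fun g => g <= m + m')%MM s.
Proof.
split=> sp m'.
  by move=> m'p; apply: sp; rewrite (perm_mem (msuppMX _ _)) map_f.
by rewrite (perm_mem (msuppMX _ _)) => /mapP[m'' /sp hm ->].
Qed.

(** Terms divisible by a member of [s] are collected in [g]; every other term must be divisible by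
    [m]. *)
Lemma monideal_cons s m p : monideal (m :: s) p <->
  exists g h, monideal s g /\ p = (g + h * 'X_[m])%R.
Proof.
split=> [sp|[g [h [sg ->]]]]; last first.
  apply: monidealD => [m' /sg /= -> |]; first by rewrite orbT.
  by apply/monidealMX => m' _ /=; rewrite lem_addr.
pose S m' := has (fun g => g <= m')%MM s.
exists (\sum_(m' <- msupp p | S m') p@_m' *: 'X_[m'])%R.
exists (\sum_(m' <- msupp p | ~~ S m') p@_m' *: 'X_[m' - m])%R; split.
  apply: monideal_sum => m' m'p Sm' m''; rewrite msuppMCX -?mcoeff_msupp // inE => /eqP->.
  exact: Sm'.
rewrite {1}[p]mpolyE (bigID S) /=; congr (_ + _)%R; rewrite mulr_suml.
rewrite big_seq_cond [RHS]big_seq_cond; apply: eq_bigr => m' /andP[m'p nSm'].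
have := sp m' m'p; rewrite /= -/(S m') (negbTE nSm') orbF => le_mm'.
by rewrite -scalerAl -mpolyXD submK.
Qed.

(** Combinatorial criterion for (s) : X^m to be generated by the variables in [S]: the first clause
    puts these variables into the colon ideal, the second makes one of them divide g / gcd(g, m) for
    every [g] in [s]. *)
Definition linear_colon (s : seq 'X_{1..n}) (m : 'X_{1..n}) (S : seq 'I_n) :=
  (forall v, v \in S -> exists2 g, g \in s & (g <= U_(v) + m)%MM) /\
  (forall g, g \in s -> exists2 v, v \in S & m v < g v).

Lemma linear_colonP s m S : linear_colon s m S ->
  forall h, monideal [seq U_(v)%MM | v <- S] h <-> monideal s (h * 'X_[m])%R.
Proof.
move=> [Ss sS] h; rewrite monidealMX; split=> sh m' /sh /hasP.
  case=> _ /mapP[v vS ->]; rewrite lep1mP => m'v.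
  have [g gs /mnm_lepP le_g] := Ss v vS; apply/hasP; exists g => //.
  apply/mnm_lepP => x; apply: (leq_trans (le_g x)); rewrite !mnmDE mnm1E addnC leq_add2l.
  by case: eqP => //= <-; rewrite lt0n.
case=> g gs le_g; have [v vS lt_mg] := sS g gs; apply/hasP; exists U_(v)%MM; first exact: map_f.
by rewrite lep1mP; move/mnm_lepP/(_ v): le_g; rewrite mnmDE; lia.
Qed.

Lemma has_betti_cons s m S f : uniq S -> linear_colon s m S ->
  has_betti (monideal s) f -> (forall i j, 0 < f i j -> j <= mdeg m + i) ->
  has_betti (monideal [seq U_(v)%MM | v <- S])
    (fun i j => (j == i.+1) * 'C(size S, i.+1)) ->
  has_betti (monideal (m :: s)) (fun i j => f i j + (j == mdeg m + i) * 'C(size S, i)).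
Proof.
move=> uS smS bs f_le bS; apply: has_betti_colon bs bS _ f_le (linear_colonP smS) _.
  by rewrite dhomogX.
exact: monideal_cons.
Qed.

Lemma has_betti_nil : has_betti (monideal [::]) (fun _ _ => 0).
Proof.
apply: has_betti_ext has_betti0 _ _ => // p; split=> [-> m|p0]; first by rewrite msupp0.
by apply: msuppnil0; case E: (msupp p) => [//|m r]; have := p0 m; rewrite E mem_head => /(_ isT).
Qed.

(* The Koszul complex, as an iterated mapping cone. *)
Lemma has_betti_vars (S : seq 'I_n) : uniq S ->
  has_betti (monideal [seq U_(v)%MM | v <- S])
    (fun i j => (j == i.+1) * 'C(size S, i.+1)).
Proof.
elim: S => [_|v S IH /= /andP[vS uS]].
  by apply: has_betti_ext has_betti_nil _ _ => // i j; rewrite bin0n muln0.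
have bS := IH uS.
(* The colon of an ideal of variables by a further variable is the ideal itself, so [bS] serves both
   as the old ideal and as the colon ideal. *)
apply: has_betti_ext (has_betti_cons (m := U_(v)%MM) uS _ bS _ bS) _ _ => //.
- split=> [w wS|g /mapP[w wS ->]].
    by exists U_(w)%MM; [apply: map_f | apply: lem_addr].
  exists w => //; rewrite !mnm1E eqxx; have [vw|//] := eqVneq v w.
  by rewrite vw wS in vS.
- by move=> i j; rewrite mdeg1; case: eqP => // ->.
- by move=> i j; rewrite mdeg1 binS mulnDr.
Qed.

Variables (G : seq 'X_{1..n}) (S : 'X_{1..n} -> seq 'I_n) (key : 'X_{1..n} -> nat).
Hypotheses (uniqG : uniq G) (uniqS : forall m, m \in G -> uniq (S m)).
Hypothesis key_inj : {in G &, injective key}.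
Hypothesis key_deg : {in G &, forall g m, key g < key m -> mdeg g <= mdeg m}.
Hypothesis key_colon : {in G, forall m,
  linear_colon [seq g <- G | key g < key m] m (S m)}.

(** Induction on a threshold for the key. By injectivity at most one generator enters at each step,
    and [key_deg] supplies the degree bound that keeps the cone minimal. *)
Lemma has_betti_linear_quotients :
  has_betti (monideal G) (fun i j => \sum_(m <- G) (j == mdeg m + i) * 'C(size (S m), i)).
Proof.
pose f (H : seq _) i j := \sum_(m <- H) (j == mdeg m + i) * 'C(size (S m), i).
pose below K := [seq g <- G | key g < K].
suff IH K : has_betti (monideal (below K)) (f (below K)).
  have <- : below (\max_(g <- G) key g).+1 = G by
    apply/all_filterP/allP => g gG; rewrite ltnS (leq_bigmax_seq _ gG).
  exact: IH.
elim: K => [|K IH].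
  by rewrite /below filter_pred0; apply: has_betti_ext has_betti_nil _ _ => // i j; rewrite /f big_nil.
have [/hasP[m mG /eqP keym]|noK] := boolP (has (fun m => key m == K) G); last first.
  rewrite (_ : below K.+1 = below K) //; apply: eq_in_filter => g gG.
  by rewrite ltnS leq_eqVlt (negbTE (hasPn noK g gG)).
have belowS : perm_eq (m :: below K) (below K.+1).
  apply: uniq_perm; rewrite /= ?filter_uniq // ?mem_filter ?keym ?ltnn // => g.
  rewrite inE !mem_filter ltnS [in RHS]leq_eqVlt -keym.
  have [->|ngm] := eqVneq g m; first by rewrite eqxx mG.
  have [gG|] := boolP (g \in G); rewrite ?andbF //.
  by rewrite (inj_in_eq key_inj) // (negbTE ngm).
have colon := key_colon mG; rewrite keym in colon.
have f_le i j : 0 < f (below K) i j -> j <= mdeg m + i.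
  rewrite lt0n sum_nat_seq_neq0 => /hasP[g]; rewrite mem_filter -keym => /andP[ltgm gG].
  by case: (j =P mdeg g + i) => // -> _; rewrite leq_add2r; apply: key_deg.
have := has_betti_cons (uniqS mG) colon IH f_le (has_betti_vars (uniqS mG)).
move/has_betti_ext; apply=> [p|i j]; first by apply: eq_monideal; apply: perm_mem.
by rewrite /f -(perm_big _ belowS) big_cons addnC.
Qed.

End LinearQuotients.

(** * Monomials in a list of variables *)

Section Monomials.
Variable n : nat.
Implicit Types (vs : seq 'I_n) (m g : 'X_{1..n}).

Definition vdeg vs m := \sum_(v <- vs) m v.

Lemma vdegD vs m g : vdeg vs (m + g)%MM = vdeg vs m + vdeg vs g.
Proof. by rewrite -big_split; apply: eq_bigr => v _; rewrite mnmDE. Qed.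

Lemma vdeg_cat vs ws m : vdeg (vs ++ ws) m = vdeg vs m + vdeg ws m.
Proof. exact: big_cat. Qed.

Lemma vdeg_cons v vs m : vdeg (v :: vs) m = m v + vdeg vs m.
Proof. exact: big_cons. Qed.

Lemma eq_vdeg vs m g : {in vs, m =1 g} -> vdeg vs m = vdeg vs g.
Proof. by move=> mg; apply: eq_big_seq. Qed.

Lemma vdeg_eq0 vs m : {in vs, forall v, m v = 0} -> vdeg vs m = 0.
Proof. by move=> m0; rewrite /vdeg big_seq big1. Qed.

Lemma vdeg1 vs v : uniq vs -> vdeg vs U_(v)%MM = (v \in vs).
Proof.
elim: vs => [|w vs IH] /=; first by rewrite /vdeg big_nil.
case/andP=> wvs uvs; rewrite vdeg_cons mnm1E inE IH //.
by case: eqP => [->|_] //; rewrite (negbTE wvs).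
Qed.

Lemma vdeg_ge1 vs v m : v \in vs -> m v <= vdeg vs m.
Proof. by move=> vvs; rewrite /vdeg (big_rem v vvs) leq_addr. Qed.

Lemma vdeg_ltP vs m g : vdeg vs m < vdeg vs g -> exists2 v, v \in vs & m v < g v.
Proof.
move=> lt_mg; have [/hasP[v]|/hasPn le_gm] := boolP (has (fun v => m v < g v) vs).
  by exists v.
have: vdeg vs g <= vdeg vs m; last by rewrite leqNgt lt_mg.
by rewrite /vdeg big_seq [leqRHS]big_seq; apply: leq_sum => v /le_gm; rewrite -leqNgt.
Qed.

(** The monomials without [v] come first, then [v] times those of one degree less. This recursion
    has the shape of Pascal's rule, which the counts below follow. *)
Fixpoint mons vs : nat -> seq 'X_{1..n} :=
  if vs is v :: vs' then
    fix mons_v d := mons vs' d ++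
      (if d is d'.+1 then [seq (U_(v) + m)%MM | m <- mons_v d'] else [::])
  else fun d => if d is 0 then [:: 0%MM] else [::].

Lemma mons0 vs : mons vs 0 = [:: 0%MM].
Proof. by elim: vs => //= v vs ->. Qed.

(** The truncated predecessor also gives the correct values for no variables: 1 in degree 0 and 0
    otherwise. *)
Lemma size_mons vs d : size (mons vs d) = 'C((size vs + d).-1, d).
Proof.
elim: vs d => [|v vs IHv] d /=; first by case: d => [|d] //=; rewrite bin_small.
elim: d => [|d IHd]; first by rewrite mons0 bin0.
by rewrite size_cat size_map IHd IHv /= !(addnS, addSn) /= binS.
Qed.

Lemma monsP vs d m : uniq vs ->
  reflect ({in [predC vs], forall v, m v = 0} /\ vdeg vs m = d) (m \in mons vs d).
Proof.
elim: vs d m => [|v vs IHv] d m /=.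
  move=> _; apply: (iffP idP).
    by case: d => //; rewrite inE => /eqP->; split=> [v|]; rewrite ?mnm0E // /vdeg big_nil.
  rewrite /vdeg big_nil => -[m0 <-]; rewrite inE; apply/eqP/mnmP => v.
  by rewrite m0 ?mnm0E.
case/andP=> vvs uvs; elim: d m => [|d IHd] m.
  rewrite mons0 inE; apply: (iffP eqP) => [->|[m0 md]].
    by split=> [w|]; [rewrite mnm0E | apply: vdeg_eq0 => w; rewrite mnm0E].
  apply/mnmP => w; rewrite mnm0E; have [wvs|/m0//] := boolP (w \in v :: vs).
  by have := vdeg_ge1 m wvs; rewrite md; case: (m w).
rewrite mem_cat; apply: (iffP orP) => [[/IHv[]// m0 md|/mapP[m' /IHd[m0 md] ->]]|[m0 md]].
- split=> [w|]; first by rewrite !inE negb_or => /andP[_ wvs]; apply: m0.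
  by rewrite vdeg_cons m0 ?add0n.
- split=> [w wvs|]; last first.
    rewrite vdegD md vdeg1 ?inE ?eqxx //=; exact/andP.
  rewrite mnmDE m0 // mnm1E addn0; case: eqP wvs => // <-.
  by rewrite !inE eqxx.
have [mv0|mv] := eqVneq (m v) 0; [left; apply/IHv => //; split | right].
- move=> w wvs; have [->//|nwv] := eqVneq w v; apply: m0.
  by rewrite !inE negb_or nwv.
- by move: md; rewrite vdeg_cons mv0.
have le_v : (U_(v) <= m)%MM by rewrite lep1mP.
apply/mapP; exists (m - U_(v))%MM; last by rewrite addmC submK.
have mE : m = (m - U_(v) + U_(v))%MM by rewrite submK.
apply/IHd; split=> [w /m0|]; first by rewrite mnmBE => ->.
move: md; rewrite {1}mE vdegD vdeg1 ?inE ?eqxx ?addn1 => [[]//|/=]; exact/andP.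
Qed.

Lemma mons_uniq vs d : uniq vs -> uniq (mons vs d).
Proof.
elim: vs d => [|v vs IHv] d /=; first by case: d.
case/andP=> vvs uvs; elim: d => [|d IHd]; first by rewrite mons0.
rewrite cat_uniq IHv // map_inj_uniq ?IHd ?andbT; last exact: addmI.
apply/hasPn => _ /mapP[m _ ->]; apply/negP => /monsP[]// /(_ v vvs).
by rewrite mnmDE mnm1E eqxx.
Qed.

Lemma mons_le vs d m : uniq vs -> d <= vdeg vs m ->
  exists2 g, g \in mons vs d & (g <= m)%MM.
Proof.
move=> uvs; elim: d => [|d IHd] le_d.
  by exists 0%MM; [rewrite mons0 inE | apply/mnm_lepP => i; rewrite mnm0E].
have [g /monsP[]// g0 gd /mnm_lepP le_gm] := IHd (ltnW le_d).
have [|v vvs lt_v] := @vdeg_ltP vs g m; first by rewrite gd.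
exists (U_(v) + g)%MM; last first.
  by apply/mnm_lepP => w; rewrite mnmDE mnm1E; case: eqP => [<-|_]; [|exact: le_gm].
apply/monsP => //; split=> [w wvs|]; last by rewrite vdegD gd vdeg1 // vvs.
rewrite mnmDE g0 // mnm1E addn0; case: eqP wvs => // <-.
by rewrite inE vvs.
Qed.

(* Variables are listed in decreasing order, so these are the variables
   smaller than the largest one dividing m. *)
Fixpoint before vs m : seq 'I_n :=
  if vs is v :: vs' then if 0 < m v then vs' else before vs' m else [::].

Lemma eq_before vs m g : {in vs, m =1 g} -> before vs m = before vs g.
Proof.
elim: vs => //= v vs IH mg; rewrite (mg v (mem_head _ _)); case: ifP => // _.
by apply: IH => w wvs; apply: mg; rewrite inE wvs orbT.
Qed.

Lemma before_subseq vs m : subseq (before vs m) vs.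
Proof.
elim: vs => //= v vs IH; case: ifP => _; first exact: subseq_cons.
exact: subseq_trans IH (subseq_cons _ _).
Qed.

Lemma before_eq0 vs m : {in vs, forall v, m v = 0} -> before vs m = [::].
Proof.
elim: vs => //= v vs IH m0; rewrite m0 ?mem_head //.
by apply: IH => w wvs; apply: m0; rewrite inE wvs orbT.
Qed.

(** Group the monomials by their largest variable: if [l] variables lie below it, the cofactor is
    any monomial of degree [d] in [l + 1] variables. *)
Lemma sum_mons vs d f : uniq vs ->
  \sum_(m <- mons vs d.+1) f (size (before vs m)) =
  \sum_(0 <= l < size vs) 'C(l + d, d) * f l.
Proof.
elim: vs => [|v vs IHv] /=; first by rewrite !big_nil.
case/andP=> vvs uvs; rewrite big_cat big_map big_nat_recr //=; congr (_ + _).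
  rewrite -IHv // big_seq [RHS]big_seq; apply: eq_bigr => m /monsP[]// m0 _.
  by rewrite m0.
rewrite (eq_bigr (fun=> f (size vs))) => [|m _]; last by rewrite mnmDE mnm1E eqxx.
by rewrite -/(mons (v :: vs)) big_const_seq count_predT size_mons iter_addn_0 mulnC.
Qed.

(** * Lexicographic comparison of exponents by numerical keys *)

Variable B : nat.

(** The exponents are digits in base [B]; below [B], numerical order is lexicographic order. *)
Fixpoint vkey vs m := if vs is v :: vs' then m v * B ^ size vs' + vkey vs' m else 0.

Lemma ltn_lex c x y p q : p < c -> q < c ->
  (x * c + p < y * c + q) = (x < y) || ((x == y) && (p < q)).
Proof.
move=> pc qc; have [lt_xy|lt_yx|->] := ltngtP x y; last by rewrite ltn_add2l.
  have : x.+1 * c <= y * c by rewrite leq_mul2r lt_xy orbT.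
  by rewrite mulSn; lia.
have : y.+1 * c <= x * c by rewrite leq_mul2r lt_yx orbT.
by rewrite mulSn; lia.
Qed.

Lemma vkey_lt vs m : (forall v, m v < B) -> vkey vs m < B ^ size vs.
Proof.
move=> mB; elim: vs => //= v vs IH; rewrite expnS.
have : (m v).+1 * B ^ size vs <= B * B ^ size vs by rewrite leq_mul2r mB orbT.
by rewrite mulSn; lia.
Qed.

Lemma vkey_cat vs ws m : vkey (vs ++ ws) m = vkey vs m * B ^ size ws + vkey ws m.
Proof.
by elim: vs => //= v vs ->; rewrite size_cat expnD mulnDl addnA mulnA.
Qed.

Lemma eq_vkey vs m g : {in vs, m =1 g} -> vkey vs m = vkey vs g.
Proof.
elim: vs => //= v vs IH mg; rewrite (mg v (mem_head _ _)) IH // => w wvs.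
by apply: mg; rewrite inE wvs orbT.
Qed.

Lemma vkey_inj vs m g : (forall v, m v < B) -> (forall v, g v < B) ->
  vkey vs m = vkey vs g -> {in vs, m =1 g}.
Proof.
move=> mB gB; elim: vs => //= v vs IH eq_k.
have mk := vkey_lt vs mB; have gk := vkey_lt vs gB.
have := ltn_lex (m v) (g v) mk gk; rewrite eq_k ltnn.
have := ltn_lex (g v) (m v) gk mk; rewrite eq_k ltnn.
move=> lt_gm lt_mg; have mgv : m v = g v by lia.
move=> w; rewrite inE => /orP[/eqP->//|]; apply: IH; lia.
Qed.

(** Where the exponents first differ, [m] has the larger one; equal degrees force [g] to exceed [m]
    at a later variable, which is thus below the largest variable of [m]. *)
Lemma vkey_before vs m g : (forall v, m v < B) -> (forall v, g v < B) ->
  vkey vs g < vkey vs m -> vdeg vs g = vdeg vs m ->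
  exists2 v, v \in before vs m & m v < g v.
Proof.
move=> mB gB; elim: vs => //= v vs IH.
rewrite !vdeg_cons ltn_lex ?vkey_lt // => /orP[lt_gm|/andP[/eqP gm lt_k]] eq_d.
  rewrite (leq_ltn_trans _ lt_gm) //; apply: vdeg_ltP; lia.
have [|w wb lt_w] := IH lt_k; first by lia.
by exists w => //; case: ifP => // _; apply: mem_subseq (before_subseq _ _) _ wb.
Qed.

(** The witness [w] is the largest variable dividing [m]. Trading it for [v] can raise an exponent
    by one, whence the sharper bound by [B]. *)
Lemma before_vkey vs m v : uniq vs -> (forall v, (m v).+1 < B) -> v \in before vs m ->
  exists2 w, w \in vs & [/\ w != v, 0 < m w & vkey vs (U_(v) + m - U_(w))%MM < vkey vs m].
Proof.
move=> uvs mB; elim: vs uvs => //= u vs IH /andP[uvs us] vb.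
have gB w x : (U_(v) + m - U_(w))%MM x < B.
  by rewrite mnmBE mnmDE !mnm1E; have := mB x; case: (v == x); lia.
case: ifP vb => [mu0 vvs|mu vb]; last have [w wvs [nwv mw lt_k]] := IH us vb.
- have nuv : u != v by apply: contraNneq uvs => ->.
  exists u; [exact: mem_head | split=> //].
  rewrite ltn_lex ?vkey_lt //; last by move=> x; apply: ltnW (mB x).
  rewrite mnmBE mnmDE !mnm1E eqxx [v == u]eq_sym (negbTE nuv); lia.
exists w; [by rewrite inE wvs orbT | split=> //].
rewrite ltn_lex ?vkey_lt //; last by move=> x; apply: ltnW (mB x).
have nuw : w != u by apply: contraNneq uvs => <-.
have nuv : v != u.
  by apply: contraNneq uvs => <-; apply: mem_subseq (before_subseq _ _) _ vb.
rewrite lt_k mnmBE mnmDE !mnm1E (negbTE nuw) (negbTE nuv); lia.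
Qed.

End Monomials.

(** * The monomial ideal of two coordinate fat points *)

Section MonomialFatPoints.
Variables (n : nat) (X Y Z : seq 'I_n) (a b : nat).
Hypotheses (XYZ_uniq : uniq (X ++ Y ++ Z)) (XYZ_all : forall v, v \in X ++ Y ++ Z).
Hypothesis leba : b <= a.
Implicit Types (m g : 'X_{1..n}).

Let uX : uniq X. Proof. by move: XYZ_uniq; rewrite cat_uniq => /andP[]. Qed.
Let uY : uniq Y. Proof. by move: XYZ_uniq; rewrite !cat_uniq => /and5P[]. Qed.
Let uZ : uniq Z. Proof. by move: XYZ_uniq; rewrite !cat_uniq => /and5P[]. Qed.
Let notX v : v \in Y ++ Z -> v \notin X.
Proof. by move: XYZ_uniq; rewrite cat_uniq => /and3P[_ /hasPn h _] /h. Qed.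
Let YnX v : v \in Y -> v \notin X.
Proof. by move=> vY; apply: notX; rewrite mem_cat vY. Qed.
Let ZnX v : v \in Z -> v \notin X.
Proof. by move=> vY; apply: notX; rewrite mem_cat vY orbT. Qed.
Let ZnY v : v \in Z -> v \notin Y.
Proof. by move: XYZ_uniq; rewrite !cat_uniq => /and5P[_ _ _ /hasPn h _] /h. Qed.
Let XnY v : v \in X -> v \notin Y.
Proof. by apply: contraL; apply: YnX. Qed.
Let XnZ v : v \in X -> v \notin Z.
Proof. by apply: contraL; apply: ZnX. Qed.
Let YnZ v : v \in Y -> v \notin Z.
Proof. by apply: contraL; apply: ZnY. Qed.

Definition gens_deg c : seq 'X_{1..n} :=
  [seq (zy + x)%MM | zy <- [seq (z + y)%MM | z <- mons Z c, y <- mons Y (a - c)],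
                     x <- mons X (b - c)].

Definition gens : seq 'X_{1..n} := [seq m | c <- iota 0 a.+1, m <- gens_deg c].

Definition is_gen m :=
  [/\ vdeg Z m <= a, vdeg Y m = a - vdeg Z m & vdeg X m = b - vdeg Z m].

Lemma mons_off vs d m : uniq vs -> m \in mons vs d -> {in [predC vs], forall v, m v = 0}.
Proof. by move=> uvs /monsP[]. Qed.

Lemma gens_decomp c z y x : z \in mons Z c -> y \in mons Y (a - c) -> x \in mons X (b - c) ->
  [/\ {in Z, (z + y + x)%MM =1 z}, {in Y, (z + y + x)%MM =1 y}
    & {in X, (z + y + x)%MM =1 x}].
Proof.
move=> /(mons_off uZ) z0 /(mons_off uY) y0 /(mons_off uX) x0.
split=> v vin; rewrite !mnmDE.
- by rewrite y0 ?x0 ?addn0 //= inE /= ?ZnX ?ZnY.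
- by rewrite z0 ?x0 ?addn0 //= inE /= ?YnX ?YnZ.
- by rewrite z0 ?y0 ?addn0 //= inE /= ?XnY ?XnZ.
Qed.

Lemma gens_degP c m : c <= a ->
  reflect ([/\ vdeg Z m = c, vdeg Y m = a - c & vdeg X m = b - c]) (m \in gens_deg c).
Proof.
move=> le_ca; apply: (iffP allpairsP).
  case=> -[_ x] /= [/allpairsP[[z y] /= [zin yin ->]] xin ->].
  have [/eq_vdeg-> /eq_vdeg-> /eq_vdeg->] := gens_decomp zin yin xin.
  by move: zin yin xin => /monsP[]// _ -> /monsP[]// _ -> /monsP[]// _ ->.
case=> dZ dY dX.
pose restr (vs : seq 'I_n) := [multinom (if v \in vs then m v else 0) | v < n].
have restrP vs d : uniq vs -> vdeg vs m = d -> restr vs \in mons vs d.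
  move=> uvs dm; apply/monsP => //; split=> [v|].
    by rewrite inE /= mnmE => /negbTE->.
  by rewrite -dm; apply: eq_vdeg => v vvs; rewrite mnmE vvs.
exists ((restr Z + restr Y)%MM, restr X) => /=; split.
- by apply/allpairsP; exists (restr Z, restr Y); split=> //=; apply: restrP.
- exact: restrP.
apply/mnmP => v; rewrite !mnmDE !mnmE.
have := XYZ_all v; rewrite !mem_cat; case: ifP => [vZ|_].
  by rewrite (negbTE (ZnY vZ)) (negbTE (ZnX vZ)) !addn0.
case: ifP => [vY|_]; first by rewrite (negbTE (YnX vY)) !addn0.
by rewrite !orbF => ->.
Qed.

Lemma gensP m : reflect (is_gen m) (m \in gens).
Proof.
apply: (iffP allpairsPdep) => [[c [m' [cin m'in ->]]]|[le_Z dY dX]].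
  have le_ca : c <= a by move: cin; rewrite mem_iota.
  by move: m'in => /(gens_degP _ le_ca)[dZ dY dX]; split; rewrite dZ.
exists (vdeg Z m), m; split=> //; first by rewrite mem_iota.
exact/gens_degP.
Qed.

Lemma gen_divides c m : c <= a -> c <= vdeg Z m -> a - c <= vdeg Y m ->
  b - c <= vdeg X m -> exists2 g, g \in gens_deg c & (g <= m)%MM.
Proof.
move=> le_ca /(mons_le uZ)[z zin /mnm_lepP le_z] /(mons_le uY)[y yin /mnm_lepP le_y].
move=> /(mons_le uX)[x xin /mnm_lepP le_x].
exists (z + y + x)%MM.
  by apply: allpairs_f => //; apply: allpairs_f.
have [Ez Ey Ex] := gens_decomp zin yin xin; apply/mnm_lepP => v.
by have := XYZ_all v; rewrite !mem_cat => /or3P[] vin; [rewrite Ex | rewrite Ey | rewrite Ez].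
Qed.

(** Summands with supports in complementary sets of variables are recovered from their sum. *)
Lemma mnm_sums_uniq (V : pred 'I_n) (s t : seq 'X_{1..n}) : uniq s -> uniq t ->
  {in s, forall m v, ~~ V v -> m v = 0} -> {in t, forall m v, V v -> m v = 0} ->
  uniq [seq (m + g)%MM | m <- s, g <- t].
Proof.
move=> us ut s0 t0.
have inj m g m' g' : m \in s -> g \in t -> m' \in s -> g' \in t ->
  (m + g = m' + g')%MM -> (m, g) = (m', g').
  move=> ms gt m's g't E; have mm' : m = m'.
    apply/mnmP => v; have [Vv|nVv] := boolP (V v).
      have := congr1 (fun h : 'X_{1..n} => h v) E; rewrite /= !mnmDE.
      by rewrite (t0 g) // (t0 g') // !addn0.
    by rewrite (s0 m) // (s0 m').
  by move: E; rewrite mm' => /addmI->.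
apply: allpairs_uniq => // -[m g] [m' g'].
by move=> /allpairsP[[? ?] /= [ms gt [-> ->]]] /allpairsP[[? ?] /= [m's g't [-> ->]]]; apply: inj.
Qed.

Lemma gens_uniq : uniq gens.
Proof.
apply: allpairs_uniq_dep => [|c _|]; first exact: iota_uniq.
  apply: (@mnm_sums_uniq [predC X]) => [||m|m /(mons_off uX) m0 v /= vX]; rewrite ?mons_uniq //.
  - apply: (@mnm_sums_uniq (mem Z)) => [||m|m]; rewrite ?mons_uniq // => /mons_off m0 v /= vZ.
      by apply: m0.
    by apply: m0 => //; rewrite inE /= ZnY.
  - case/allpairsP=> -[z y] /= [/(mons_off uZ) z0 /(mons_off uY) y0 ->] v.
    by rewrite negbK => vX; rewrite mnmDE z0 ?y0 // inE /= ?XnY ?XnZ.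
  by apply: m0.
move=> [c m] [c' m'] /allpairsPdep[c1 [m1 [cin hm E1]]] /allpairsPdep[c2 [m2 [cin' hm' E2]]].
rewrite E1 E2 /= => m12; subst m2.
have le1 : c1 <= a by move: cin; rewrite mem_iota.
have le2 : c2 <= a by move: cin'; rewrite mem_iota.
by move: hm hm' => /(gens_degP _ le1)[<- _ _] /(gens_degP _ le2)[<- _ _].
Qed.

Local Notation B := (a + b).+2.
Local Notation vars := (X ++ Y ++ Z).

(* Compares by decreasing z-degree, then reverse lexicographically; the base [B]
   exceeds every exponent of a generator, so there is no carry. *)
Definition key m := (a - vdeg Z m) * B ^ size vars + vkey B vars m.

(** Below z-degree [a], any z times [m] is a multiple of a generator of larger z-degree, which
    precedes [m]. At z-degree [a] only exchanges inside [Z] remain. *)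
Definition colon_vars m :=
  (if vdeg Z m == a then before Z m else Z) ++ before Y m ++ before X m.

Lemma vdeg_vars m : vdeg vars m = mdeg m.
Proof.
rewrite mdegE; apply: perm_big; apply: uniq_perm => //; first exact: index_enum_uniq.
by move=> v; rewrite XYZ_all mem_index_enum.
Qed.

Lemma gen_mdeg m : is_gen m -> mdeg m = (b - vdeg Z m) + a.
Proof. by move=> [le_Z dY dX]; rewrite -vdeg_vars !vdeg_cat; lia. Qed.

Lemma gen_small m : is_gen m -> forall v, (m v).+1 < B.
Proof.
move=> gm v; have := vdeg_ge1 m (XYZ_all v); rewrite vdeg_vars gen_mdeg //; lia.
Qed.

Lemma key_lt m g : is_gen m -> is_gen g ->
  (key m < key g) = (vdeg Z g < vdeg Z m) || (vdeg Z m == vdeg Z g) &&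
    ((vkey B X m < vkey B X g) || (vkey B X m == vkey B X g) &&
      ((vkey B Y m < vkey B Y g) || (vkey B Y m == vkey B Y g) &&
        (vkey B Z m < vkey B Z g))).
Proof.
move=> gm gg; have smallm v := ltnW (gen_small gm v); have smallg v := ltnW (gen_small gg v).
rewrite ltn_lex ?vkey_lt // !vkey_cat ltn_lex; last 2 first.
- by rewrite -vkey_cat vkey_lt.
- by rewrite -vkey_cat vkey_lt.
rewrite ltn_lex ?vkey_lt //.
move: gm gg => [le_m _ _] [le_g _ _]; congr (_ || _ && _); lia.
Qed.

Lemma key_inj : {in gens &, injective key}.
Proof.
move=> m g /gensP gm /gensP gg eq_k.
have smallm v := ltnW (gen_small gm v); have smallg v := ltnW (gen_small gg v).
have eq_vk : vkey B vars m = vkey B vars g.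
  have := ltn_lex (a - vdeg Z m) (a - vdeg Z g) (vkey_lt vars smallm) (vkey_lt vars smallg).
  have := ltn_lex (a - vdeg Z g) (a - vdeg Z m) (vkey_lt vars smallg) (vkey_lt vars smallm).
  move: eq_k; rewrite /key => ->; rewrite ltnn; lia.
by apply/mnmP => v; apply: (vkey_inj smallm smallg eq_vk).
Qed.

(** A smaller key means at least the same z-degree, and by [gen_mdeg] the degree does not increase
    with the z-degree. *)
Lemma key_mdeg : {in gens &, forall g m, key g < key m -> mdeg g <= mdeg m}.
Proof.
move=> g m /gensP gg /gensP gm; rewrite key_lt // !gen_mdeg //; lia.
Qed.

Lemma colon_vars_uniq m : uniq (colon_vars m).
Proof.
have uZYX : uniq (Z ++ Y ++ X).
  by rewrite uniq_catC -catA uniq_catCA.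
apply: subseq_uniq uZYX; rewrite !cat_subseq ?before_subseq //.
by case: ifP => _ //; apply: before_subseq.
Qed.

Lemma vdeg_exchange (vs : seq 'I_n) v w m : uniq vs -> 0 < m w ->
  vdeg vs (U_(v) + m - U_(w))%MM = (v \in vs) + vdeg vs m - (w \in vs).
Proof.
move=> uvs mw; have mE : (U_(v) + m - U_(w) + U_(w) = U_(v) + m)%MM.
  by rewrite submK // lep1mP mnmDE; lia.
by have := congr1 (vdeg vs) mE; rewrite !vdegD !vdeg1 // => <-; rewrite addnK.
Qed.

Lemma exchange_off (vs : seq 'I_n) v w m : v \notin vs -> w \notin vs ->
  {in vs, (U_(v) + m - U_(w))%MM =1 m}.
Proof.
move=> vvs wvs x xvs; rewrite mnmBE mnmDE !mnm1E.
have [vx|_] := eqVneq v x; first by rewrite vx xvs in vvs.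
by have [wx|_] := eqVneq w x; [rewrite wx xvs in wvs | rewrite subn0].
Qed.

Lemma gens_colon : {in gens, forall m,
  linear_colon [seq g <- gens | key g < key m] m (colon_vars m)}.
Proof.
move=> m /gensP gm; have small := gen_small gm; have [le_Z dY dX] := gm.
split=> [v|g]; last first.
  rewrite mem_filter => /andP[lt_k /gensP gg]; move: lt_k; have [le_Zg dYg dXg] := gg.
  have smallm v := ltnW (small v); have smallg v := ltnW (gen_small gg v).
  (* Either [g] has larger z-degree, and all of [Z] is available, or the degrees agree in each block
     and [vkey_before] applies to the first block whose keys differ. *)
  rewrite key_lt // => /orP[lt_Z|/andP[/eqP eq_Z]].
    have [v vZ lt_v] := vdeg_ltP lt_Z; exists v => //.
    by rewrite /colon_vars ltn_eqF ?(leq_trans lt_Z) // mem_cat vZ.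
  case/orP=> [/(vkey_before smallm smallg)|/andP[_]].
    case=> [|v vX lt_v]; first by rewrite dX dXg eq_Z.
    by exists v => //; rewrite !mem_cat vX !orbT.
  case/orP=> [/(vkey_before smallm smallg)|/andP[_]].
    case=> [|v vY lt_v]; first by rewrite dY dYg eq_Z.
    by exists v => //; rewrite !mem_cat vY !orbT.
  case/(vkey_before smallm smallg) => // v vZ lt_v; exists v => //.
  rewrite mem_cat; case: ifP => _; rewrite ?vZ //.
  by rewrite (mem_subseq (before_subseq _ _) vZ).
(* Exchanging [w] for [v] yields a divisor of the product of [v] and [m]; [w] will be the largest
   variable of [m] in the block of [v]. *)
have exchangeP w : 0 < m w -> is_gen (U_(v) + m - U_(w))%MM ->
    key (U_(v) + m - U_(w))%MM < key m ->
    exists2 g, g \in [seq g <- gens | key g < key m] & (g <= U_(v) + m)%MM.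
  move=> mw gg lt_k; exists (U_(v) + m - U_(w))%MM; last exact: lem_subr.
  by rewrite mem_filter lt_k; apply/gensP.
rewrite !mem_cat => /or3P[].
- case: ifP => [_ vb|neq_Z vZ].
    have vZ := mem_subseq (before_subseq _ _) vb.
    have [w wZ [_ mw lt_k]] := before_vkey uZ small vb.
    have off (vs : seq 'I_n) : {in vs, forall x, x \notin Z} -> {in vs, (U_(v) + m - U_(w))%MM =1 m}.
      move=> vsZ; apply: exchange_off; apply/negP => /vsZ; rewrite ?vZ ?wZ //.
    have gg : is_gen (U_(v) + m - U_(w))%MM.
      by rewrite /is_gen !vdeg_exchange // vZ wZ addKn (negbTE (ZnX vZ))
        (negbTE (ZnX wZ)) (negbTE (ZnY vZ)) (negbTE (ZnY wZ)) !subn0.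
    apply: (exchangeP w) => //; rewrite key_lt // vdeg_exchange // vZ wZ addKn eqxx ltnn.
    rewrite (eq_vkey _ (off _ XnZ)) (eq_vkey _ (off _ YnZ)) lt_k.
    by rewrite !eqxx !ltnn.
  (* No exchange here: the extra z allows a generator of z-degree one higher, which needs no more y
     or x than [m] has. *)
  have lt_Z : vdeg Z m < a by rewrite ltn_neqAle neq_Z.
  have [|||g] := @gen_divides (vdeg Z m).+1 (U_(v) + m)%MM lt_Z.
  - by rewrite vdegD vdeg1 // vZ.
  - by rewrite vdegD dY; lia.
  - by rewrite vdegD dX; lia.
  move=> /(gens_degP _ lt_Z)[gZ gY gX] le_g; exists g => //.
  have gg : is_gen g by rewrite /is_gen gZ.
  by rewrite mem_filter key_lt // gZ ltnSn; apply/gensP.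
- move=> vb; have vY := mem_subseq (before_subseq _ _) vb.
  have [w wY [_ mw lt_k]] := before_vkey uY small vb.
  have gZ : vdeg Z (U_(v) + m - U_(w))%MM = vdeg Z m.
    by rewrite vdeg_exchange // (negbTE (YnZ vY)) (negbTE (YnZ wY)) subn0.
  have gg : is_gen (U_(v) + m - U_(w))%MM.
    by rewrite /is_gen gZ !vdeg_exchange // vY wY addKn (negbTE (YnX vY)) (negbTE (YnX wY)) subn0.
  apply: (exchangeP w) => //; rewrite key_lt // gZ eqxx.
  by rewrite (eq_vkey _ (exchange_off _ (YnX vY) (YnX wY))) lt_k !eqxx !orbT.
- move=> vb; have vX := mem_subseq (before_subseq _ _) vb.
  have [w wX [_ mw lt_k]] := before_vkey uX small vb.
  have gZ : vdeg Z (U_(v) + m - U_(w))%MM = vdeg Z m.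
    by rewrite vdeg_exchange // (negbTE (XnZ vX)) (negbTE (XnZ wX)) subn0.
  have gg : is_gen (U_(v) + m - U_(w))%MM.
    by rewrite /is_gen gZ !vdeg_exchange // vX wX addKn (negbTE (XnY vX)) (negbTE (XnY wX)) subn0.
  by apply: (exchangeP w) => //; rewrite key_lt // gZ eqxx lt_k !orbT.
Qed.

(** Contribution of the generators of z-degree [c], which all have degree [(b - c) + a], in
    homological degree [i]. *)
Definition strand c i :=
  \sum_(z <- mons Z c) \sum_(y <- mons Y (a - c)) \sum_(x <- mons X (b - c))
    'C((if c == a then size (before Z z) else size Z) +
       (size (before Y y) + size (before X x)), i).

Lemma sum_gens i j :
  \sum_(m <- gens) (j == mdeg m + i) * 'C(size (colon_vars m), i) =
  \sum_(0 <= c < a.+1) (j == (b - c) + a + i) * strand c i.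
Proof.
rewrite big_allpairs_dep /index_iota subn0 big_seq [RHS]big_seq.
apply: eq_bigr => c; rewrite mem_iota => /= le_ca.
rewrite big_seq (eq_bigr (fun m => (j == (b - c) + a + i) * 'C(size (colon_vars m), i))).
  rewrite -big_seq -big_distrr /=; congr (_ * _).
  rewrite big_allpairs_dep big_allpairs_dep big_seq [RHS]big_seq; apply: eq_bigr => z zin.
  rewrite big_seq [RHS]big_seq; apply: eq_bigr => y yin.
  rewrite big_seq [RHS]big_seq; apply: eq_bigr => x xin.
  have [Ez Ey Ex] := gens_decomp zin yin xin; rewrite !size_cat.
  rewrite (eq_vdeg Ez) (eq_before Ey) (eq_before Ex).
  rewrite (_ : vdeg Z z = c); last by case/monsP: zin.
  by case: ifP => _ //; rewrite (eq_before Ez).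
move=> m /(gens_degP _ le_ca)[dZ dY dX]; rewrite (gen_mdeg (m := m)) ?dZ //.
by rewrite /is_gen dZ.
Qed.

(** At [c = a] the generators are monomials in [Z] alone, and [sum_mons] applies to them. *)
Lemma strand_top i : 0 < a ->
  strand a i = \sum_(0 <= l < size Z) 'C(l + a.-1, a.-1) * 'C(l, i).
Proof.
rewrite /strand eqxx subnn (eqP (_ : b - a == 0)) //; case: a => // d _.
rewrite -(sum_mons d (fun s => 'C(s, i))) //; apply: eq_bigr => z _.
by rewrite !mons0 !big_seq1 !(before_eq0 (m := 0%MM)) ?addn0 // => v; rewrite mnm0E.
Qed.

(** No x occurs, and the z-part matters only through its number of choices, since the whole of [Z]
    lies in the colon ideal. *)
Lemma strand_mid c i : b <= c < a ->
  strand c i = 'C((size Z + c).-1, c) *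
    \sum_(0 <= l < size Y) 'C(l + (a - c).-1, (a - c).-1) * 'C(size Z + l, i).
Proof.
move=> /andP[le_bc lt_ca]; rewrite /strand ltn_eqF //.
rewrite big_const_seq count_predT size_mons iter_addn_0 mulnC; congr (_ * _).
have -> : b - c = 0 by lia.
case E: (a - c) => [|d]; first by lia.
rewrite -(sum_mons d (fun s => 'C(size Z + s, i))) //; apply: eq_bigr => y _.
by rewrite mons0 big_seq1 (before_eq0 (m := 0%MM)) ?addn0 // => v; rewrite mnm0E.
Qed.

(** Now the y- and x-parts both have positive degree, so [sum_mons] is used once for each. *)
Lemma strand_low c i : c < b ->
  strand c i = 'C((size Z + c).-1, c) *
    \sum_(0 <= l1 < size Y) \sum_(0 <= l2 < size X)
      'C(l1 + (a - c).-1, (a - c).-1) * 'C(l2 + (b - c).-1, (b - c).-1) *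
      'C(size Z + l1 + l2, i).
Proof.
move=> lt_cb; have lt_ca := leq_trans lt_cb leba; rewrite /strand ltn_eqF //.
rewrite big_const_seq count_predT size_mons iter_addn_0 mulnC; congr (_ * _).
case E: (a - c) => [|d]; first by lia.
case E': (b - c) => [|d']; first by lia.
rewrite (eq_bigr (fun l1 => 'C(l1 + d, d) *
  \sum_(0 <= l2 < size X) 'C(l2 + d', d') * 'C(size Z + (l1 + l2), i))); last first.
  by move=> l1 _; rewrite big_distrr /=; apply: eq_bigr => l2 _; rewrite mulnA addnA.
rewrite -(sum_mons d (fun s => \sum_(0 <= l2 < size X) 'C(l2 + d', d') * 'C(size Z + (s + l2), i))) //.
apply: eq_bigr => y _.
by rewrite -(sum_mons d' (fun s => 'C(size Z + (size (before Y y) + s), i))).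
Qed.

Variable k : fieldType.
Local Notation R := {mpoly k[n]}.

(** The ideal of the two fat points in adapted coordinates: the variables vanishing at the first
    point are [Y ++ Z], those vanishing at the second [X ++ Z]. *)
Definition monomial_fat_ideal (p : R) := forall m, m \in msupp p ->
  a <= vdeg (Y ++ Z) m /\ b <= vdeg (X ++ Z) m.

Lemma monideal_gens p : monideal gens p <-> monomial_fat_ideal p.
Proof.
split=> hp m /hp.
  case/hasP => g /gensP[le_Z dY dX] /mnm_lepP le_g; rewrite !vdeg_cat.
  have le_vdeg vs : vdeg vs g <= vdeg vs m by apply: leq_sum.
  have := le_vdeg Z; have := le_vdeg Y; have := le_vdeg X; lia.
(* A divisor is found by using as much z-degree as a generator may have. *)
rewrite !vdeg_cat => -[le_a le_b]; pose c := minn (vdeg Z m) a.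
have [||||g gin le_g] := @gen_divides c m; try (rewrite /c; lia).
apply/hasP; exists g => //; apply/allpairsPdep.
by exists c, g; split=> //; rewrite mem_iota /c; lia.
Qed.

Lemma has_betti_monomial_fat_ideal :
  has_betti monomial_fat_ideal
    (fun i j => \sum_(0 <= c < a.+1) (j == (b - c) + a + i) * strand c i).
Proof.
have := has_betti_linear_quotients k gens_uniq (fun m _ => colon_vars_uniq m)
  key_inj key_mdeg gens_colon.
by move/has_betti_ext; apply=> [p|i j]; [apply: monideal_gens | rewrite sum_gens].
Qed.

End MonomialFatPoints.

(** * Automorphisms of the polynomial ring *)

Section Transport.
Import GRing.Theory.
Local Open Scope ring_scope.
Variables (k : fieldType) (n : nat).
Local Notation R := {mpoly k[n]}.
Variables phi psi : {rmorphism R -> R}.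
Hypotheses (phiK : cancel phi psi) (psiK : cancel psi phi).
Hypothesis psi_homog : forall d p, p \is d.-homog -> psi p \is d.-homog.

Lemma homog_entry_psi d e p : homog_entry d e p -> homog_entry d e (psi p).
Proof.
rewrite /homog_entry; case: ifP => _; first exact: psi_homog.
by move=> /eqP->; rewrite rmorph0.
Qed.

(** Keeps minimality under [psi]: an entry between equal shifts is a constant, hence zero, and one
    between different shifts never has a constant term. *)
Lemma homog_entry_psi0 d e p : homog_entry d e p -> p@_0%MM = 0 -> (psi p)@_0%MM = 0.
Proof.
have [<- hp p0|ned /homog_entry_psi/homog_entry_coeff0->//] := eqVneq d e.
suff -> : p = 0 by rewrite rmorph0 mcoeff0.
move: hp; rewrite /homog_entry leqnn subnn => /dhomogP hp.
apply/mpolyP => m; rewrite mcoeff0; have [/hp/eqP|/memN_msupp_eq0//] := boolP (m \in msupp p).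
by rewrite mdeg_eq0 => /eqP->.
Qed.

(** Apply [psi] to all matrices of a resolution; entrywise [phi] and [psi] match the kernels and
    images of the two complexes. *)
Lemma has_betti_transport (I : R -> Prop) f :
  has_betti I f -> has_betti (fun p => I (phi p)) f.
Proof.
move=> [F [[[grF graF] [im0 ex0 ex] minF] Ff]].
pose F' : free_complex k n := @FreeComplex k n (grank F) (@gshift _ _ F)
  (fun i => map_mx psi (gdiff F i)) (map_mx psi (gaug F)).
have phimx p q (A : 'M[R]_(p, q)) : map_mx phi (map_mx psi A) = A.
  by apply/matrixP => i j; rewrite !mxE psiK.
have psimx p q (A : 'M[R]_(p, q)) : map_mx psi (map_mx phi A) = A.
  by apply/matrixP => i j; rewrite !mxE phiK.
have kerE p q (A : 'M[R]_(p, q)) (v : 'rV_p) : v *m map_mx psi A = 0 <-> map_mx phi v *m A = 0.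
  split=> [/(congr1 (map_mx phi))|/(congr1 (map_mx psi))]; rewrite map_mx0 map_mxM ?phimx //.
  by rewrite psimx.
have imE p q (A : 'M[R]_(p, q)) (v : 'rV_q) :
    (exists w, map_mx phi v = w *m A) <-> exists w, v = w *m map_mx psi A.
  split=> [[w /(congr1 (map_mx psi))]|[w ->]].
    by rewrite psimx map_mxM => ->; exists (map_mx psi w).
  by exists (map_mx phi w); rewrite map_mxM phimx.
exists F'; split; last exact: Ff.
split.
- by split=> [i p q|p]; rewrite mxE; [exact: homog_entry_psi (grF i p q) | exact: homog_entry_psi (graF p)].
- split=> [p|v|i v]; last 2 first.
  + by rewrite kerE -imE; apply: ex0.
  + by rewrite kerE -imE; apply: ex.
  rewrite im0; split=> -[v vp].
    exists (map_mx psi v); rewrite -map_mxM mxE vp; exact: phiK.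
  by exists (map_mx phi v); rewrite -vp -[X in (_ *m X) _ _ = _]phimx -map_mxM mxE.
by move=> i p q; rewrite mxE; apply: homog_entry_psi0 (grF i p q) (minF _ _ _).
Qed.

End Transport.

(** * Powers of ideals generated by variables, up to an automorphism *)

Section IdealPowers.
Import GRing.Theory.
Local Open Scope ring_scope.

Lemma ideal_gen_mem (A : comNzRingType) (S : A -> Prop) f : S f -> ideal_gen S f.
Proof.
move=> Sf; exists [:: (1, f)]; split=> [c|]; first by rewrite inE => /eqP->.
by rewrite big_seq1 mul1r.
Qed.

Lemma ideal_gen_mull (A : comNzRingType) (S : A -> Prop) c f :
  ideal_gen S f -> ideal_gen S (c * f).
Proof.
move=> [s [sS ->]]; exists [seq (c * x.1, x.2) | x <- s]; split=> [_ /mapP[x /sS Sx ->]//|].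
by rewrite big_map big_distrr /=; apply: eq_bigr => x _; rewrite mulrA.
Qed.

Lemma ideal_gen_sum (A : comNzRingType) (S : A -> Prop) (I : eqType) (r : seq I) F :
  (forall i, i \in r -> ideal_gen S (F i)) -> ideal_gen S (\sum_(i <- r) F i).
Proof.
rewrite big_seq => hF; elim/big_ind: _ => [|f g [s [sS ->]] [t [tS ->]]|i /hF//].
  by exists [::]; split=> //; rewrite big_nil.
exists (s ++ t); split=> [c|]; last by rewrite big_cat.
by rewrite mem_cat => /orP[/sS|/tS].
Qed.

Variables (k : fieldType) (n : nat).
Local Notation R := {mpoly k[n]}.
Variables phi psi : {rmorphism R -> R}.
Hypotheses (phiK : cancel phi psi) (psiK : cancel psi phi).
Variable W : seq 'I_n.
Hypothesis uW : uniq W.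

(** Describes the [a]-th power of the ideal generated by the variables in [W]. *)
Definition order_ge a (p : R) := forall m, m \in msupp p -> (a <= vdeg W m)%N.

Lemma order_geD a p q : order_ge a p -> order_ge a q -> order_ge a (p + q).
Proof. by move=> hp hq m /msuppD_le; rewrite mem_cat => /orP[/hp|/hq]. Qed.

Lemma order_geM a b p q : order_ge a p -> order_ge b q -> order_ge (a + b) (p * q).
Proof.
move=> hp hq m /msuppM_le/allpairsP[[m1 m2] /= [/hp h1 /hq h2 ->]].
by rewrite vdegD leq_add.
Qed.

Lemma order_ge_sum a (I : eqType) (r : seq I) (P : pred I) F :
  (forall i, i \in r -> P i -> order_ge a (F i)) -> order_ge a (\sum_(i <- r | P i) F i).
Proof.
rewrite big_seq_cond => hF; elim/big_ind: _ => [m|p q|i /andP[]]; last exact: hF.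
  by rewrite msupp0.
exact: order_geD.
Qed.

Lemma order_geX v c : v \in W -> order_ge 1 (c *: 'X_v).
Proof.
by move=> vW m /msuppZ_le; rewrite msuppX inE => /eqP->; rewrite vdeg1 // vW.
Qed.

(** Each term of [p] contains a variable of [W]; splitting one off lowers the order by one. This
    serves both for powers and for the point ideal itself. *)
Lemma order_ge_ind a p (S : R -> Prop) : order_ge a.+1 p ->
  (forall v q, v \in W -> order_ge a q -> ideal_gen S (psi (q * 'X_v))) ->
  ideal_gen S (psi p).
Proof.
move=> hp hS; rewrite [p]mpolyE rmorph_sum; apply: ideal_gen_sum => m mp.
have /vdeg_ltP[v vW] : (vdeg W 0%MM < vdeg W m)%N.
  rewrite [vdeg W 0%MM]vdeg_eq0; first exact: leq_trans (hp m mp).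
  by move=> v _; rewrite mnm0E.
rewrite mnm0E => mv; have mE : m = (m - U_(v) + U_(v))%MM by rewrite submK // lep1mP -lt0n.
rewrite {2}mE mpolyXD scalerAl; apply: hS => // m' /msuppZ_le.
rewrite msuppX inE => /eqP->; have := hp m mp.
by rewrite {1}mE vdegD vdeg1 // vW addn1.
Qed.

Lemma ideal_pow_order (I : R -> Prop) : (forall f, I f <-> order_ge 1 (phi f)) ->
  forall a f, ideal_pow I a f <-> order_ge a (phi f).
Proof.
move=> hI; elim=> [|a IH] f; first by split.
split=> [[s [sS ->]]|hf].
  rewrite rmorph_sum; apply: order_ge_sum => c /sS[g [h [/hI Ig /IH Ih ->]]] _.
  by rewrite !rmorphM /=; apply: (@order_geM 0 a.+1) => //; apply: (@order_geM 1 a).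
rewrite -[f]phiK; apply: order_ge_ind hf _ => v q vW hq.
apply: ideal_gen_mem; exists (psi 'X_v), (psi q); split.
- by apply/hI; rewrite psiK -['X_v]scale1r; apply: order_geX.
- by apply/IH; rewrite psiK.
by rewrite rmorphM mulrC.
Qed.

End IdealPowers.

(** * Linear changes of coordinates *)

Section CoordinateChange.
Import GRing.Theory.
Local Open Scope ring_scope.
Variables (k : fieldType) (r : nat) (n : 'I_r -> nat).
Local Notation N := (\sum_(i < r) (n i).+1)%N.
Local Notation R := {mpoly k[N]}.
Local Notation frame := (forall i, 'M[k]_((n i).+1)).

Definition subst_tuple (B : frame) : N.-tuple R :=
  [tuple linear_form (row (tagnat.sig2 s) (B (tagnat.sig1 s))) | s < N].

Definition subst (B : frame) (p : R) : R := p \mPo subst_tuple B.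

HB.instance Definition _ B := GRing.RMorphism.copy (subst B) (comp_mpoly (subst_tuple B)).

Lemma substZ B c p : subst B (c *: p) = c *: subst B p.
Proof. exact: comp_mpolyZ. Qed.

Lemma subst_sum B I (s : seq I) (F : I -> R) :
  subst B (\sum_(x <- s) F x) = \sum_(x <- s) subst B (F x).
Proof. exact: rmorph_sum. Qed.

Lemma substX B m : subst B 'X_[m] = \prod_s subst B 'X_s ^+ m s.
Proof. by rewrite mpolyXE_id /subst rmorph_prod; apply: eq_bigr => s _; rewrite rmorphXn. Qed.

Lemma linear_form_sum i (I : Type) (s : seq I) (c : I -> k) (v : I -> 'rV[k]_(n i).+1) :
  linear_form (\sum_(x <- s) c x *: v x) = \sum_(x <- s) c x *: linear_form (v x).
Proof.
rewrite /linear_form (eq_bigr (fun x => \sum_j (c x * v x 0 j) *: coord_var k j)); last first.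
  by move=> x _; rewrite scaler_sumr; apply: eq_bigr => j _; rewrite scalerA.
rewrite exchange_big; apply: eq_bigr => j _; rewrite summxE scaler_suml.
by apply: eq_bigr => x _; rewrite mxE.
Qed.

Lemma subst_coord B i (j : 'I_(n i).+1) :
  subst B (coord_var k j) = linear_form (row j (B i)).
Proof.
rewrite /subst comp_mpolyXU -tnth_nth tnth_mktuple.
rewrite /tagnat.sig1 /tagnat.sig2 /tagnat.Rank tagnat.rankK /=.
by [].
Qed.

Lemma subst_linear_form B i (v : 'rV[k]_(n i).+1) :
  subst B (linear_form v) = linear_form (v *m B i).
Proof.
rewrite mulmx_sum_row linear_form_sum subst_sum; apply: eq_bigr => j _.
by rewrite substZ subst_coord.
Qed.

Lemma linear_form_delta i (j : 'I_(n i).+1) : linear_form (delta_mx 0 j) = coord_var k j.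
Proof.
rewrite /linear_form (bigD1 j) //= mxE !eqxx scale1r [X in _ + X]big1 ?addr0 // => l nlj.
by rewrite mxE (negbTE nlj) scale0r.
Qed.

(** Coefficient rows of linear forms are multiplied on the right, so [subst C] after [subst B] acts
    through [B i *m C i]. *)
Lemma substK B C : (forall i, B i *m C i = 1%:M) -> cancel (subst B) (subst C).
Proof.
move=> BC p; rewrite [in LHS](mpolyE p) [RHS](mpolyE p) (subst_sum B) (subst_sum C).
apply: eq_bigr => m _; rewrite !substZ; congr (_ *: _).
rewrite substX [RHS]mpolyXE_id /subst rmorph_prod; apply: eq_bigr => s _.
rewrite rmorphXn /= -/(subst _ _) -/(subst _ _); congr (_ ^+ _).
rewrite -[s]tagnat.sig2K -/(coord_var k _) subst_coord subst_linear_form.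
by rewrite -row_mul BC row1 linear_form_delta.
Qed.

Lemma linear_form_homog i (v : 'rV[k]_(n i).+1) : linear_form v \is 1.-homog.
Proof.
by apply: rpred_sum => j _; rewrite dhomogZ // dhomogX /= mdeg1.
Qed.

Lemma subst_homog B d p : p \is d.-homog -> subst B p \is d.-homog.
Proof.
move=> /dhomogP hp; rewrite [p]mpolyE subst_sum [X in X \is _]big_seq; apply: rpred_sum => m /hp /= <-.
rewrite substZ dhomogZ // substX mdegE.
apply: (big_ind2 (fun (q : R) e => q \is e.-homog)) => [|p1 d1 p2 d2|s _].
- exact: dhomog1.
- exact: dhomogM.
rewrite -[X in X.-homog]mul1n; apply: dhomogMn.
by rewrite -[s]tagnat.sig2K -/(coord_var k _) subst_coord linear_form_homog.
Qed.

Variables (B C : frame).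
Hypotheses (BC : forall i, B i *m C i = 1%:M) (CB : forall i, C i *m B i = 1%:M).
Variables (P : multi_point k n) (j0 : forall i, 'I_(n i).+1) (W : seq 'I_N).
Hypothesis uW : uniq W.
Hypothesis WE : forall i (j : 'I_(n i).+1), (tagnat.Rank i j \in W) = (j != j0 i).
Hypothesis P_col : forall i (v : 'rV[k]_(n i).+1),
  (forall w, w \in val (P i) -> \sum_j v 0 j * w 0 j = 0) <-> (v *m B i) 0 (j0 i) = 0.

(** In the new coordinates a linear form vanishing at [P i] lacks the variable [j0 i]; conversely
    [subst C] carries the variables in [W] to forms vanishing at [P]. *)
Lemma point_ideal_order f : point_ideal P f <-> order_ge W 1 (subst B f).
Proof.
split=> [[s [sS ->]]|hf].
  rewrite rmorph_sum; apply: order_ge_sum => c /sS[i [v [/P_col v0 cE]]] _.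
  rewrite rmorphM /= cE subst_linear_form; apply: (@order_geM _ _ _ 0 1) => //.
  apply: order_ge_sum => j _ _; have [->|nj] := eqVneq j (j0 i).
    by rewrite v0 scale0r => m; rewrite msupp0.
  by apply: order_geX; rewrite // WE.
rewrite -[f](substK BC); apply: order_ge_ind hf _ => // v q vW _.
rewrite rmorphM; apply: ideal_gen_mull; apply: ideal_gen_mem.
exists (tagnat.sig1 v), (row (tagnat.sig2 v) (C (tagnat.sig1 v))); split.
  apply/P_col; rewrite -row_mul CB row1 mxE eqxx /=.
  move: vW; rewrite -{1}[v]tagnat.sig2K WE => nj; by rewrite eq_sym (negbTE nj).
by rewrite /= -{1}[v]tagnat.sig2K -/(coord_var k _) subst_coord.
Qed.

End CoordinateChange.

(** * Bases adapted to two distinct points *)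

Section Frames.
Import GRing.Theory.
Local Open Scope ring_scope.
Variable k : fieldType.

(** Spanning vectors of two distinct lines are independent; a basis of a complement of their span
    completes them to the rows of [A]. Positivity of [l] makes [inord 1] the index 1. *)
Lemma exists_frame l (U V : {vspace 'rV[k]_l.+1}) :
  \dim U = 1 -> \dim V = 1 -> U != V -> (0 < l)%N ->
  exists A : 'M[k]_l.+1, [/\ A \in unitmx, U = <[row ord0 A]>%VS & V = <[row (inord 1) A]>%VS].
Proof.
move=> dU dV neUV l_gt0.
have lineE (T : {vspace 'rV[k]_l.+1}) : \dim T = 1 -> vpick T != 0 /\ T = <[vpick T]>%VS.
  move=> dT; have nz : vpick T != 0 by rewrite vpick0 -dimv_eq0 dT.
  by split=> //; apply/esym/eqP; rewrite eqEdim dim_vline nz dT -memvE memv_pick.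
have [nzp UE] := lineE _ dU; have [nzq VE] := lineE _ dV.
set p := vpick U in nzp UE; set q := vpick V in nzq VE.
have free_pq : free [:: p; q].
  rewrite free_cons span_seq1 seq1_free nzq andbT; apply: contraNN neUV.
  rewrite -VE memvE -UE => le_UV; by rewrite eqEdim le_UV dU dV.
pose S := <<[:: p; q]>>%VS; pose s := [:: p; q] ++ vbasis S^C%VS.
have basis_s : basis_of fullv s.
  rewrite -(addv_complf S); apply: cat_basis (vbasisP _).
    by apply/directv_addP; apply: capv_compl.
  by rewrite /basis_of eqxx.
have size_s : size s = l.+1.
  have := @vector.size_basis _ _ _ _ (in_tuple s) basis_s; rewrite dimvf => <-.
  by rewrite /dim /= mul1n.
exists (\matrix_i s`_i); split.
- rewrite -row_free_unit; apply: inj_row_free => v.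
  rewrite mulmx_sum_row => v0; apply/rowP => i; rewrite mxE.
  have sz : size s == l.+1 by rewrite size_s.
  have /freeP free_s : free (Tuple sz) := basis_free basis_s.
  apply: (free_s (fun i => v 0 i)).
  by rewrite -[RHS]v0; apply: eq_bigr => j _; rewrite rowK.
- by rewrite rowK.
- by rewrite rowK inordK.
Qed.

End Frames.

(** * Binomial identities *)

Section Binomials.

(** At [x = 0] the convention for top -1 agrees with the truncated predecessor, as both sides are 1
    for [q = 0] and 0 otherwise. *)
Lemma binz_pred x q : binz (x%:Z - 1) q = 'C(x.-1, q).
Proof.
case: x => [|x]; first by case: q.
by rewrite (_ : (x.+1%:Z - 1)%R = Posz x) //; lia.
Qed.

Lemma binz_pred2 x q : binz (x%:Z - 2) q = 'C(x.-2, q).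
Proof.
case: x => [|[|x]]; [by case: q | by case: q |].
by rewrite (_ : (x.+2%:Z - 2)%R = Posz x) //; lia.
Qed.

(** For [i <= l] both sides are the multinomial coefficient (l + d)! / (d! i! (l - i)!). *)
Lemma mul_bin_bin l d i : 'C(l + d, d) * 'C(l, i) = 'C(l + d, d + i) * 'C(d + i, i).
Proof.
have [le_il|lt_li] := leqP i l; last by rewrite (bin_small lt_li) [X in _ = X * _]bin_small ?muln0 //; lia.
have e1 := bin_fact (leq_addl l d); have e2 := bin_fact le_il.
have le_dil : d + i <= l + d by lia.
have e3 := bin_fact le_dil; have e4 := bin_fact (leq_addl d i).
rewrite addnK in e1; rewrite addnK in e4; rewrite (_ : l + d - (d + i) = l - i) in e3; last by lia.
have pos : 0 < d`! * i`! * (l - i)`! by rewrite !muln_gt0 !fact_gt0.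
apply/eqP; rewrite -(eqn_pmul2r pos); apply/eqP.
transitivity (l + d)`!; [rewrite -e1 -e2 | rewrite -e3 -e4].
  by move: 'C(l + d, d) 'C(l, i) d`! i`! (l - i)`! => *; ring.
by move: 'C(l + d, d + i) 'C(d + i, i) d`! i`! (l - i)`! => *; ring.
Qed.

Lemma sum_bin_bin M d i :
  \sum_(0 <= l < M) 'C(l + d, d) * 'C(l, i) = 'C(M + d, d.+1 + i) * 'C(d + i, i).
Proof.
elim: M => [|M IH]; first by rewrite big_nil (@bin_small d) //; lia.
by rewrite big_nat_recr //= IH mul_bin_bin addSn [in RHS]addSn binS mulnDl.
Qed.

Lemma sum_bin M i : \sum_(0 <= l < M) 'C(l, i) = 'C(M, i.+1).
Proof.
elim: M => [|M IH]; first by rewrite big_nil.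
by rewrite big_nat_recr //= IH binS addnC.
Qed.

(* The two summands are the Betti numbers of the powers b - 1 and b of the
   maximal ideal in M variables: [I^(b-1) / I^b] is a sum of copies of the field. *)
Lemma bin_power_step M b s : 0 < b ->
  'C((M + b).-2, b - 1 + s) * 'C((b + s).-2, s) +
    (if s is s'.+1 then 'C((M + b).-1, b + s') * 'C((b + s').-1, s') else 0) =
  'C((M + (b - 1)).-1, b - 1) * 'C(M, s).
Proof.
case: b => // t _; rewrite subn1 /=.
case: s => [|s]; first by rewrite !bin0 !addn0 addnS.
case: M => [|M]; first by rewrite bin0n muln0 (@bin_small _ (t + s.+1)) ?(@bin_small _ (t.+1 + s)) //; lia.
transitivity ('C(M + t, t + s.+1) * 'C(t + s, s.+1) + 'C((M + t).+1, (t + s).+1) * 'C(t + s, s)).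
  by congr ('C(_, _) * 'C(_, _) + 'C(_, _) * 'C(_, _)); lia.
have h0 := mul_bin_bin M t s; have h1 := mul_bin_bin M t s.+1.
rewrite (_ : (M.+1 + t).-1 = M + t) // !binS.
rewrite mulnDr h0 h1 addnS binS; nia.
Qed.

Lemma sum_ord_eq s i (h : nat -> nat) :
  \sum_(x < i.+1 | s + x == i) h x = if s <= i then h (i - s) else 0.
Proof.
case: leqP => [le_si|lt_is]; last by rewrite big1 // => x /eqP; lia.
have lt_x : i - s < i.+1 by lia.
rewrite (big_pred1 (Ordinal lt_x)) // => x /=.
by apply/eqP/eqP => [|->]; [move=> ?; apply: val_inj => /=; lia | rewrite /=; lia].
Qed.

Lemma Vandermonde2 s l m i : s <= i ->
  \sum_(x < i.+1) \sum_(y < i.+1 | s + x + y == i) 'C(l, x) * 'C(m, y) = 'C(l + m, i - s).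
Proof.
move=> le_si; rewrite -binomial.Vandermonde.
rewrite (big_ord_widen_cond i.+1 xpredT (fun x => 'C(l, x) * 'C(m, i - s - x))); last by lia.
rewrite [RHS]big_mkcond; apply: eq_bigr => x _ /=.
rewrite (sum_ord_eq (s + x) i (fun y => 'C(l, x) * 'C(m, y))) ltnS subnDA.
by rewrite -[in RHS](leq_add2l s) subnKC.
Qed.

Lemma Vandermonde3 l1 l2 l3 i :
  \sum_(x < i.+1) \sum_(y < i.+1) \sum_(z < i.+1 | x + y + z == i)
    'C(l1, x) * 'C(l2, y) * 'C(l3, z) = 'C(l1 + l2 + l3, i).
Proof.
rewrite -addnA -binomial.Vandermonde; apply: eq_bigr => x _.
rewrite -Vandermonde2; last by rewrite -ltnS.
rewrite big_distrr; apply: eq_bigr => y _; rewrite big_distrr.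
by apply: eq_bigr => z _ /=; rewrite mulnA.
Qed.

(** Absorbs the shift of the total into the third index, so that the two triple sums can be added
    term by term with [bin_power_step]. *)
Lemma sum3_shift i (F : nat -> nat -> nat -> nat) :
  \sum_(x < i) \sum_(y < i) \sum_(z < i | (x + y + z).+1 == i) F x y z =
  \sum_(x < i.+1) \sum_(y < i.+1) \sum_(z < i.+1 | x + y + z == i)
    (if (z : nat) is z'.+1 then F x y z' else 0).
Proof.
have zE x y : \sum_(z < i.+1 | x + y + z == i) (if (z : nat) is z'.+1 then F x y z' else 0) =
    \sum_(z < i | (x + y + z).+1 == i) F x y z.
  rewrite big_mkcond big_ord_recl /= if_same add0n [RHS]big_mkcond.
  by apply: eq_bigr => z _; rewrite /bump /= addnS.
rewrite [RHS]big_ord_recr /= [X in _ = _ + X]big1 ?addn0 => [|y _]; last first.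
  by rewrite zE big1 // => z /eqP; lia.
apply: eq_bigr => x _; rewrite big_ord_recr /= zE [X in _ = _ + X]big1 ?addn0; last first.
  by move=> z /eqP; lia.
by apply: eq_bigr => y _; rewrite zE.
Qed.

(** [bin_power_step] merges the two sums, leaving ['C(M, i3)]. The factors with [i1] and [i2] are
    expanded by [sum_bin] and [sum_bin_bin] as sums over [l2] and [l1], and Vandermonde convolution
    then removes [i1], [i2], [i3]. *)
Lemma sum3_strand r d M b i : 0 < b ->
  \sum_(i1 < i.+1) \sum_(i2 < i.+1) \sum_(i3 < i.+1 | i1 + i2 + i3 == i)
    'C(r, 1 + i1) * 'C(r + d, d + 1 + i2) * 'C(d + i2, i2) *
    'C((M + b).-2, b - 1 + i3) * 'C((b + i3).-2, i3) +
  \sum_(i1 < i) \sum_(i2 < i) \sum_(i3 < i | (i1 + i2 + i3).+1 == i)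
    'C(r, 1 + i1) * 'C(r + d, d + 1 + i2) * 'C(d + i2, i2) *
    'C((M + b).-1, b + i3) * 'C((b + i3).-1, i3) =
  'C((M + (b - 1)).-1, b - 1) *
    \sum_(0 <= l1 < r) \sum_(0 <= l2 < r) 'C(l1 + d, d) * 'C(M + l1 + l2, i).
Proof.
move=> b_gt0.
rewrite (sum3_shift i (fun x y z => 'C(r, 1 + x) * 'C(r + d, d + 1 + y) * 'C(d + y, y) *
    'C((M + b).-1, b + z) * 'C((b + z).-1, z))).
transitivity (\sum_(i1 < i.+1) \sum_(i2 < i.+1) \sum_(i3 < i.+1 | i1 + i2 + i3 == i)
    \sum_(0 <= l1 < r) \sum_(0 <= l2 < r) 'C((M + (b - 1)).-1, b - 1) *
      ('C(l1 + d, d) * ('C(l2, i1) * 'C(l1, i2) * 'C(M, i3)))).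
  rewrite -big_split; apply: eq_bigr => x _; rewrite -big_split; apply: eq_bigr => y _.
  rewrite -big_split; apply: eq_bigr => z _ /=.
  transitivity ('C(r, x.+1) * ('C(r + d, d.+1 + y) * 'C(d + y, y)) *
      ('C((M + (b - 1)).-1, b - 1) * 'C(M, z))).
    rewrite -bin_power_step // add1n addn1 mulnDr; congr (_ + _); first by rewrite !mulnA.
    by case: (z : nat) => [|z']; rewrite ?muln0 // !mulnA.
  rewrite -sum_bin_bin -sum_bin mulnC big_distrlr /= exchange_big /= big_distrr /=.
  apply: eq_bigr => l1 _; rewrite big_distrr; apply: eq_bigr => l2 _ /=.
  by move: 'C(_, _) 'C(_, _) 'C(_, _) 'C(_, _) 'C(_, _) => *; ring.
have swap (I : finType) (p : pred I) (F : nat -> nat -> I -> nat) :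
    \sum_(0 <= l1 < r) \sum_(0 <= l2 < r) \sum_(x | p x) F l1 l2 x =
    \sum_(x | p x) \sum_(0 <= l1 < r) \sum_(0 <= l2 < r) F l1 l2 x.
  by rewrite [RHS]exchange_big; apply: eq_bigr => l1 _; rewrite [RHS]exchange_big.
transitivity (\sum_(0 <= l1 < r) \sum_(0 <= l2 < r)
    \sum_(i1 < i.+1) \sum_(i2 < i.+1) \sum_(i3 < i.+1 | i1 + i2 + i3 == i)
      'C((M + (b - 1)).-1, b - 1) * ('C(l1 + d, d) * ('C(l2, i1) * 'C(l1, i2) * 'C(M, i3)))).
  rewrite swap; apply: eq_bigr => x _; rewrite swap; apply: eq_bigr => y _.
  by rewrite swap.
rewrite big_distrr; apply: eq_bigr => l1 _; rewrite big_distrr; apply: eq_bigr => l2 _ /=.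
rewrite (_ : M + l1 + l2 = l2 + l1 + M); last by lia.
rewrite -Vandermonde3 !big_distrr; apply: eq_bigr => x _.
by rewrite !big_distrr; apply: eq_bigr => y _; rewrite !big_distrr.
Qed.

End Binomials.

(** * Two fat points *)

Section TwoFatPoints.
Import GRing.Theory.
Local Open Scope ring_scope.
Variables (k : fieldType) (r : nat) (n : 'I_r -> nat).
Hypothesis n_gt0 : forall i, (0 < n i)%N.
Local Notation N := (\sum_(i < r) (n i).+1)%N.
Variables P Q : multi_point k n.

(** If the [i]-th coordinates agreed, the product of this one point with all the other factors would
    have minimal dimension 0 and contain both points. *)
Lemma general_position_neq : P != Q -> linear_general_position [:: P; Q] ->
  forall i, val (P i) != val (Q i).
Proof.
move=> nPQ gen i; apply/eqP => PQi.
pose d j := if j == i then 0%N else n j.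
pose L j : {vspace 'rV[k]_(n j).+1} := if j == i then val (P j) else fullv.
have d0 : d i = 0%N by rewrite /d eqxx.
have linL : is_linear_subspace d L.
  split=> [j|]; last by exists i; rewrite d0.
  rewrite /L /d; case: eqP => _; first exact: (eqP (valP (P j))).
  by rewrite dimvf /dim /= mul1n.
have LP : on_subspace L P.
  by apply/forallP => j; rewrite /L; case: eqP => // _; apply: subvf.
have LQ : on_subspace L Q.
  apply/forallP => j; rewrite /L; case: eqP => [->|_]; last exact: subvf.
  by rewrite PQi.
have := gen d L linL i; rewrite d0 /= inE (negbTE nPQ) /= LP LQ.
by move/(_ (fun j => leq0n (d j))).
Qed.

(** The transpose appears because linear forms are dual to points: entry [j] of [v *m A^T] pairs [v]
    with row [j] of [A]. *)
Lemma line_orthogonal l (U : {vspace 'rV[k]_l.+1}) (A : 'M[k]_l.+1) j (v : 'rV[k]_l.+1) :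
  U = <[row j A]>%VS ->
  (forall w, w \in U -> \sum_x v 0 x * w 0 x = 0) <-> (v *m A^T) 0 j = 0.
Proof.
move=> ->; have vA : (v *m A^T) 0 j = \sum_x v 0 x * row j A 0 x.
  by rewrite mxE; apply: eq_bigr => x _; rewrite !mxE.
split=> [h|vA0 w /vlineP[c ->]]; first by rewrite vA h // memv_line.
rewrite (eq_bigr (fun x => c * (v 0 x * row j A 0 x))) => [|x _]; last by rewrite !mxE; ring.
by rewrite -big_distrr /= -vA vA0 mulr0.
Qed.

Definition coord_list (j : forall i, 'I_(n i).+1) : seq 'I_N :=
  [seq tagnat.Rank i (j i) | i <- enum 'I_r].

Lemma coord_listE j i x : (tagnat.Rank i x \in coord_list j) = (x == j i).
Proof.
apply/mapP/eqP => [[i' _ /(congr1 val)/eqP]|->]; last by exists i; rewrite ?mem_enum.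
by rewrite tagnat.eq_Rank => /andP[/eqP <- /eqP/val_inj].
Qed.

Lemma coord_list_uniq j : uniq (coord_list j).
Proof.
rewrite map_inj_uniq ?enum_uniq // => i i' /(congr1 val)/eqP.
by rewrite tagnat.eq_Rank => /andP[/eqP].
Qed.

Lemma size_coord_list j : size (coord_list j) = r.
Proof. by rewrite size_map size_enum_ord. Qed.

Lemma has_betti_two_fat_points a b : (b <= a)%N ->
  (forall i, val (P i) != val (Q i)) ->
  exists X Y Z : seq 'I_N,
    [/\ uniq (X ++ Y ++ Z), [/\ size X = r, size Y = r & size Z = (\sum_i n i - r)%N]
      & has_betti (two_fat_points_ideal P Q a b)
          (fun i j => \sum_(0 <= c < a.+1) (j == (b - c) + a + i) * strand X Y Z a b c i)%N].
Proof.
move=> leba nPQ.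
have frame i := exists_frame (eqP (valP (P i))) (eqP (valP (Q i))) (nPQ i) (n_gt0 i).
pose A i := sval (constructive_indefinite_description _ (frame i)).
have hA i : [/\ A i \in unitmx, val (P i) = <[row ord0 (A i)]>%VS
    & val (Q i) = <[row (inord 1) (A i)]>%VS].
  exact: svalP (constructive_indefinite_description _ (frame i)).
pose B i := (A i)^T; pose C i := invmx (B i).
have unitB i : B i \in unitmx by rewrite unitmx_tr; case: (hA i).
have BC i : B i *m C i = 1%:M by apply: mulmxV.
have CB i : C i *m B i = 1%:M by apply: mulVmx.
pose X := coord_list (fun i => ord0 : 'I_(n i).+1).
pose Y := coord_list (fun i => inord 1 : 'I_(n i).+1).
pose Z := [seq v <- enum 'I_N | v \notin X ++ Y].
have n01 i : (ord0 == inord 1 :> 'I_(n i).+1) = false.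
  by apply/eqP => /(congr1 val); rewrite /= inordK ?ltnS //; apply: n_gt0.
have XY_disj : ~~ has (mem X) Y.
  apply/hasPn => _ /mapP[i _ ->] /=; by rewrite coord_listE eq_sym n01.
have uZ : uniq Z by rewrite filter_uniq // enum_uniq.
have uXYZ : uniq (X ++ Y ++ Z).
  rewrite catA cat_uniq cat_uniq !coord_list_uniq XY_disj uZ /= andbT.
  by apply/hasPn => v; rewrite mem_filter => /andP[].
have XYZ_all v : v \in X ++ Y ++ Z.
  by rewrite catA mem_cat /Z mem_filter mem_enum andbT orbN.
have uYZ : uniq (Y ++ Z) by move: uXYZ; rewrite cat_uniq => /and3P[].
have uXZ : uniq (X ++ Z).
  by move: uXYZ; rewrite uniq_catCA cat_uniq => /and3P[].
exists X, Y, Z; split=> //.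
  split; rewrite ?size_coord_list //.
  have : size (X ++ Y ++ Z) = N.
    rewrite -[RHS]size_enum_ord; apply: perm_size; apply: uniq_perm => //; first exact: enum_uniq.
    by move=> v; rewrite XYZ_all mem_enum.
  rewrite !size_cat !size_coord_list => sz.
  (* All factors together have this many variables; removing the [r] in [X] and the [r] in [Y]
     leaves the size of [Z]. *)
  have NE : N = (\sum_i n i + r)%N.
    rewrite (eq_bigr (fun i => n i + 1)%N) => [|i _]; last by rewrite addn1.
    by rewrite big_split /= sum1_card card_ord.
  by move: sz NE; lia.
have WP i (j : 'I_(n i).+1) : (tagnat.Rank i j \in Y ++ Z) = (j != ord0).
  have := XYZ_all (tagnat.Rank i j); move: uXYZ; rewrite cat_uniq [in X in _ -> X -> _]mem_cat.
  rewrite coord_listE => /and3P[_ /hasPn YZnX _]; case: eqP => [->|] //= _.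
  by apply/negP => /YZnX; rewrite /= coord_listE eqxx.
have WQ i (j : 'I_(n i).+1) : (tagnat.Rank i j \in X ++ Z) = (j != inord 1).
  have := XYZ_all (tagnat.Rank i j); move: uXYZ; rewrite uniq_catCA cat_uniq.
  have -> : (tagnat.Rank i j \in X ++ Y ++ Z) = (tagnat.Rank i j \in Y ++ X ++ Z).
    by rewrite !mem_cat orbCA.
  rewrite [in X in _ -> X -> _]mem_cat.
  rewrite coord_listE => /and3P[_ /hasPn XZnY _]; case: eqP => [->|] //= _.
  by apply/negP => /XZnY; rewrite /= coord_listE eqxx.
have PE := point_ideal_order BC CB uYZ WP (fun i v => line_orthogonal v (let: And3 _ h _ := hA i in h)).
have QE := point_ideal_order BC CB uXZ WQ (fun i v => line_orthogonal v (let: And3 _ _ h := hA i in h)).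
have phiK := substK BC; have psiK := substK CB.
have Ppow := ideal_pow_order phiK psiK uYZ PE; have Qpow := ideal_pow_order phiK psiK uXZ QE.
have := has_betti_transport phiK psiK (@subst_homog _ _ _ C)
  (has_betti_monomial_fat_ideal uXYZ XYZ_all leba k).
move/has_betti_ext; apply=> // p; split=> [hp|[hP hQ] m mp].
  by split; [apply/Ppow => m /hp[] | apply/Qpow => m /hp[]].
by split; [apply: (Ppow a p).1 | apply: (Qpow b p).1].
Qed.

End TwoFatPoints.

Local Open Scope nat_scope.

Theorem corollary6p13 (k : fieldType) (r : nat) (n : 'I_r -> nat)
    (r_gt0 : 0 < r) (n_gt0 : forall i, 0 < n i)
    (P Q : multi_point k n) (neqPQ : P != Q)
    (a b : nat) (b_gt0 : 0 < b) (leba : b <= a)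
    (genPQ : linear_general_position [:: P; Q]) :
  let N := \sum_(i < r) n i in
  let beta := betti (two_fat_points_ideal P Q a b) in
  [/\ forall i, beta i (i + a) =
        binz (N%:Z - r%:Z + a%:Z - 1) (a + i) * binz (a%:Z + i%:Z - 1) i
        + \sum_(1 <= j < (a - b).+1) \sum_(0 <= l < r)
            binz (l%:Z + j%:Z - 1) (j - 1)
            * binz (N%:Z - r%:Z + a%:Z - j%:Z - 1) (a - j)
            * binz (N%:Z - r%:Z + l%:Z) i,
      forall i, beta i (i + a + 1) =
        \sum_(i1 < i.+1) \sum_(i2 < i.+1) \sum_(i3 < i.+1 | i1 + i2 + i3 == i)
            binz r%:Z (1 + i1)
            * binz (r%:Z + a%:Z - b%:Z) (a - b + 1 + i2)
            * binz (a%:Z - b%:Z + i2%:Z) i2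
            * binz (N%:Z - r%:Z + b%:Z - 2) (b - 1 + i3)
            * binz (b%:Z + i3%:Z - 2) i3
        + \sum_(i1 < i) \sum_(i2 < i) \sum_(i3 < i | (i1 + i2 + i3).+1 == i)
            binz r%:Z (1 + i1)
            * binz (r%:Z + a%:Z - b%:Z) (a - b + 1 + i2)
            * binz (a%:Z - b%:Z + i2%:Z) i2
            * binz (N%:Z - r%:Z + b%:Z - 1) (b + i3)
            * binz (b%:Z + i3%:Z - 1) i3,
      forall i j, 2 <= j <= b -> beta i (i + a + j) =
        \sum_(0 <= l1 < r) \sum_(0 <= l2 < r)
            binz (N%:Z - r%:Z + b%:Z - j%:Z - 1) (b - j)
            * binz (l1%:Z + a%:Z - b%:Z + j%:Z - 1) (a - b + j - 1)
            * binz (l2%:Z + j%:Z - 1) (j - 1)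
            * binz (N%:Z - r%:Z + l1%:Z + l2%:Z) i
    & forall i j, (forall t, t <= b -> j <> i + a + t) -> beta i j = 0].
Proof.
move=> N beta.
have [X [Y [Z [uXYZ [sX sY sZ] hbeta]]]] :=
  has_betti_two_fat_points n_gt0 leba (general_position_neq n_gt0 neqPQ genPQ).
(* Every [n i] is positive, so the natural number [M] below is the true difference. *)
have le_rN : r <= N.
  by rewrite -[leqLHS]card_ord -sum1_card /N; apply: leq_sum => i _; apply: n_gt0.
set M := N - r in sZ.
have NrE : (Posz N - Posz r)%R = Posz M by rewrite /M; lia.
have [S [betaE Stop Smid Slow]] : exists S : nat -> nat -> nat,
    [/\ forall i j, beta i j = \sum_(0 <= c < a.+1) (j == (b - c) + a + i) * S c i,
        forall i, S a i = \sum_(0 <= l < M) 'C(l + a.-1, a.-1) * 'C(l, i),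
        forall c i, b <= c < a -> S c i = 'C((M + c).-1, c) *
          \sum_(0 <= l < r) 'C(l + (a - c).-1, (a - c).-1) * 'C(M + l, i)
      & forall c i, c < b -> S c i = 'C((M + c).-1, c) *
          \sum_(0 <= l1 < r) \sum_(0 <= l2 < r)
            'C(l1 + (a - c).-1, (a - c).-1) * 'C(l2 + (b - c).-1, (b - c).-1) *
            'C(M + l1 + l2, i)].
  exists (strand X Y Z a b); rewrite -sZ; split=> [i j|i|c i hc|c i hc].
  - exact: betti_has_betti hbeta.
  - by apply: (strand_top uXYZ leba); lia.
  - by have := strand_mid uXYZ leba i hc; rewrite sY.
  - by have := strand_low uXYZ leba i hc; rewrite sY sX.
clear X Y Z uXYZ sX sY sZ hbeta.
(* Above the lowest generating degree, only the z-degree [c = b - t] produces generators of degree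
   [a + t]. *)
have single i t : 1 <= t <= b ->
    beta i (i + a + t) = S (b - t) i.
  move=> ht; rewrite betaE (big_cat_nat (n := b - t)) //=; last by lia.
  rewrite big1_seq ?add0n => [|c]; last first.
    by rewrite mem_index_iota => hc; case: eqP => //; lia.
  rewrite big_ltn; last by lia.
  rewrite big1_seq ?addn0 => [|c]; last first.
    by rewrite mem_index_iota => hc; case: eqP => //; lia.
  by case: eqP => [_|]; rewrite ?mul1n //; lia.
rewrite !NrE; split=> [i|i|i j hj|i j hj].
(* Degree [a] collects all [c] from [b] to [a]: the term [c = a] gives the first product, the others
   the double sum. *)
- rewrite betaE (big_cat_nat (n := b)) //=; last by lia.
  rewrite big1_seq ?add0n => [|c]; last first.
    by rewrite mem_index_iota => hc; case: eqP => //; lia.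
  rewrite big_nat_recr //= addnC (_ : i + a == b - a + a + i); last by apply/eqP; lia.
  rewrite mul1n Stop.
  congr (_ + _).
    rewrite sum_bin_bin -!PoszD !binz_pred.
    by congr ('C(_, _) * 'C(_, _)); lia.
  (* Reverses the range, so that summation index [j] of the theorem corresponds to [c = a - j]. *)
  rewrite big_nat_rev big_add1 /= -[b in index_iota b _]add0n big_addn.
  apply: eq_big_nat => j hj; have -> : b + a - (j + b).+1 = a - j.+1 by lia.
  rewrite (_ : i + a == b - (a - j.+1) + a + i); last by apply/eqP; lia.
  rewrite mul1n Smid //; last by lia.
  rewrite big_distrr; apply: eq_bigr => l _ /=.
  rewrite (_ : (Posz M + Posz a - Posz j.+1 - 1)%R = (Posz (M + (a - j.+1)) - 1)%R); last by lia.
  rewrite -!PoszD !binz_pred mulnCA mulnA.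
  by congr ('C(_, _) * 'C(_, _) * 'C(_, _)); lia.
(* For [c = b - 1] the x-part has degree 1, so its binomial weight is 1 and the left side of
   [sum3_strand] appears. *)
- rewrite single; last by lia.
  rewrite Slow //; last by lia.
  rewrite (_ : a - (b - 1) = (a - b).+1); last by lia.
  rewrite (_ : b - (b - 1) = 1) /=; last by lia.
  transitivity ('C((M + (b - 1)).-1, b - 1) *
    \sum_(0 <= l1 < r) \sum_(0 <= l2 < r) 'C(l1 + (a - b), a - b) * 'C(M + l1 + l2, i)).
    congr (_ * _); apply: eq_bigr => l1 _; apply: eq_bigr => l2 _.
    by rewrite bin0 muln1.
  rewrite -sum3_strand // (_ : (Posz r + Posz a - Posz b)%R = Posz (r + (a - b))); last by lia.
  rewrite (_ : (Posz a - Posz b)%R = Posz (a - b)); last by lia.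
  by congr (_ + _); apply: eq_bigr => x _; apply: eq_bigr => y _; apply: eq_bigr => z _;
    rewrite -!PoszD ?binz_pred ?binz_pred2.
- rewrite single; last by lia.
  rewrite Slow //; last by lia.
  rewrite big_distrr; apply: eq_bigr => l1 _; rewrite big_distrr; apply: eq_bigr => l2 _ /=.
  rewrite (_ : (Posz M + Posz b - Posz j - 1)%R = (Posz (M + (b - j)) - 1)%R); last by lia.
  rewrite (_ : (Posz l1 + Posz a - Posz b + Posz j - 1)%R = (Posz (l1 + (a - b + j)) - 1)%R); last by lia.
  rewrite -!PoszD !binz_pred !mulnA.
  by congr ('C(_, _) * 'C(_, _) * 'C(_, _) * 'C(_, _)); lia.
- rewrite betaE big1_seq // => c; rewrite mem_index_iota => hc.
  by case: eqP => // jE; case: (hj (b - c)); lia.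
Qed.
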